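(* Suppose the true regression function $f_0\in\mathfrak{C}_\alpha(Q)$ for some $\alpha>1/2$ and $Q>0$, and $f$ is assigned the finite random series prior $\Pi$ described in the context. Then there exists some sufficiently large constant $M>0$ such that $$\mathbb{E}_0\left[\Pi\left(\|f-f_0\|_2>Mn^{-\alpha/(2\alpha+1)}(\log n)^{t}\mid\mathcal{D}_n\right)\right]\to0\quad(n\to\infty)$$ for any $t>\alpha/(2\alpha+1)$.
   Context: Model: $x_1,\dots,x_n$ are i.i.d. $\mathrm{Unif}(0,1)$, $y_i=f_0(x_i)+e_i$ with $e_i$ i.i.d. $\mathrm{N}(0,\sigma^2)$ independent of the design points, $\sigma^2>0$ known; $\mathcal{D}_n=(x_i,y_i)_{i=1}^n$; $\mathbb{E}_0$ is expectation under this true model. With $p_f(x,y)=\phi_\sigma(y-f(x))$, $\phi_\sigma$ the $\mathrm{N}(0,\sigma^2)$ density, the posterior is $\Pi(f\in A\mid\mathcal{D}_n)=\int_A\prod_{i=1}^n p_f(x_i,y_i)\,\Pi(\mathrm{d}f)\big/\int\prod_{i=1}^n p_f(x_i,y_i)\,\Pi(\mathrm{d}f)$. $\|\cdot\|_2$ is the $L_2([0,1])$-norm. Functions: $\psi_1(x)=1$, $\psi_{2k}(x)=\sin k\pi x$, $\psi_{2k+1}(x)=\cos k\pi x$, $k\in\mathbb{N}_+$. The $\alpha$-Hölder ball is $$\mathfrak{C}_\alpha(Q)=\left\{f(x)=\sum_{k=1}^\infty\beta_k\psi_k(x):\ \sum_{k=1}^\infty k^\alpha|\beta_k|\le Q\right\}.$$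 Finite random series prior: $f=\sum_{k=1}^\infty\beta_k\psi_k$, where first an integer-valued $N$ is drawn from a probability mass function $\pi_N$ on $\mathbb{N}_+$, and then given $N=m$ the $\beta_k$ are independent, with $\beta_k$ having density $g$ for $1\le k\le m$ and $\beta_k=0$ for $k>m$. Here $g(x)\propto\exp(-\tau_0|x|^\tau)$ for some $\tau,\tau_0>0$, and $\pi_N$ satisfies, for some constants $b_0,b_1>0$, $$\pi_N(m)\ge\exp(-b_0m\log m)\quad\text{and}\quad\sum_{N=m+1}^\infty\pi_N(N)\le\exp(-b_1m\log m)\qquad\text{for all integers }m\ge2.$$ The prior does not depend on $\alpha$ or $Q$. *)

(* Defs.v *)
From HB Require Import structures.
From mathcomp Require Import all_boot all_order all_algebra.
From mathcomp Require Import all_classical all_reals all_analysis.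

Set Implicit Arguments.
Unset Strict Implicit.
Unset Printing Implicit Defensive.

Import Order.TTheory GRing.Theory Num.Theory.
Import numFieldNormedType.Exports.

Local Open Scope classical_set_scope.
Local Open Scope ring_scope.

Section iid.
Context d (T : measurableType d) (R : realType).

Definition consp n (z : T * n.-tuple T) : n.+1.-tuple T := [tuple of z.1 :: z.2].

Lemma measurable_consp n : measurable_fun setT (@consp n).
Proof. exact: measurable_cons. Qed.

HB.instance Definition _ n :=
  isMeasurableFun.Build _ _ _ _ (@consp n) (@measurable_consp n).

(* The n-fold product P ⊗ ... ⊗ P, i.e. the law of n i.i.d. draws from P. *)
Fixpoint iid (P : probability T R) n : probability (n.-tuple T) R :=
  if n is n'.+1 then distribution (P \x iid P n')%E (@consp n')
  else dirac [tuple].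

End iid.

Section function_spaces.
Context (R : realType).

(* Sequences are indexed by the integers k >= 1: the terms of index 0 never
   enter a sum. *)
Definition psi (k : nat) (x : R) : R :=
  if k == 1%N then 1
  else if odd k then cos (k./2%:R * pi * x) else sin (k./2%:R * pi * x).

Definition holder_ball (alpha Q : R) : set (R -> R) :=
  [set f | exists b : nat -> R,
    (forall x : R, x \in `[0, 1] ->
      \sum_(1 <= k < n) b k * psi k x @[n --> \oo] --> f x) /\
    (\sum_(1 <= k <oo) (k%:R `^ alpha * `|b k|)%:E <= Q%:E)%E].

(* Only used for sequences that are almost surely eventually 0, for which the
   sums are eventually constant. *)
Definition rseries (b : nat -> R) (x : R) : R :=
  limn (fun n => \sum_(1 <= k < n) b k * psi k x).

(* f \_ D is f on D and 0 outside D. *)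
Definition L2norm (f : R -> R) : \bar R :=
  ('N[@lebesgue_measure R]_(2%:E)[(EFin \o f) \_ `[0%R, 1%R]])%E.

End function_spaces.

Section prior.
Context (R : realType).

Definition coordinate_sets : set (set (nat -> R)) :=
  \bigcup_k preimage_set_system setT (fun b : nat -> R => b k) measurable.

(* Real sequences with the product sigma-algebra. *)
Definition coefs := g_sigma_algebraType coordinate_sets.

(* The sequence (0, b_1, ..., b_m, 0, 0, ...). *)
Definition coefs_of_tuple m (b : m.-tuple (measurableTypeR R)) : coefs :=
  fun k => if k is j.+1 then nth 0 b j else 0.

Lemma measurable_coefs_of_tuple m :
  measurable_fun [set: m.-tuple (measurableTypeR R)] (@coefs_of_tuple m).
Proof.
apply: (@measurability _ _ (m.-tuple (measurableTypeR R)) coefs setT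
  (@coefs_of_tuple m) coordinate_sets) => //.
move=> _ [_ [k _ [B mB <-]] <-].
have mk : measurable_fun [set: m.-tuple (measurableTypeR R)]
    (fun b : m.-tuple (measurableTypeR R) => coefs_of_tuple b k).
  case: k => [|j] /=; first exact: measurable_cst.
  have [jm|mj] := ltnP j m.
    rewrite (_ : (fun _ => _) = @tnth _ (measurableTypeR R) ^~ (Ordinal jm)).
      exact: measurable_tnth.
    by apply/funext => b; rewrite (tnth_nth 0).
  rewrite (_ : (fun _ => _) = cst 0); first exact: measurable_cst.
  by apply/funext => b; rewrite nth_default// size_tuple.
by rewrite !setTI; have := mk measurableT B mB; rewrite setTI.
Qed.

HB.instance Definition _ m :=
  isMeasurableFun.Build _ _ _ _ (@coefs_of_tuple m)
    (@measurable_coefs_of_tuple m).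

(* The law of the coefficient sequence: m is drawn from piN, then b_1, ..., b_m
   are drawn independently from G and the other coefficients are 0. *)
Definition random_series_prior (piN : nat -> {nonneg R})
    (G : probability (measurableTypeR R) R) : {measure set coefs -> \bar R} :=
  mseries
    (fun m => mscale (piN m) (distribution (iid G m) (@coefs_of_tuple m))) 1.

End prior.

Section model.
Context (R : realType) (sigma : R).

Definition density (f : R -> R) (z : R * R) : R :=
  normal_pdf 0 sigma (z.2 - f z.1).

Definition likelihood n (D : n.-tuple (R * R)) (f : R -> R) : R :=
  \prod_(i < n) density f (tnth D i).

(* The prior on functions is the law of rseries b under Pi. *)
Definition posterior (Pi : {measure set coefs R -> \bar R})
    n (D : n.-tuple (R * R)) (A : set (R -> R)) : R :=
  fine (\int[Pi]_(b in @rseries R @^-1` A) (likelihood D (rseries b))%:E)%E /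
  fine (\int[Pi]_b (likelihood D (rseries b))%:E)%E.

(* The joint law of the pairs (x_i, e_i), i = 1, ..., n; sigma is a standard
   deviation in normal_prob and normal_pdf. *)
Definition design_noise n :
    probability (n.-tuple (measurableTypeR R * measurableTypeR R)) R :=
  iid (uniform_prob (@ltr01 R) \x normal_prob 0 sigma)%E n.

Definition data (f0 : R -> R) n (w : n.-tuple (R * R)) : n.-tuple (R * R) :=
  [tuple of [seq (z.1, f0 z.1 + z.2) | z <- w]].

End model.

(* Main.v *)
(** Put X = (n / ln n)^(1/(2 alpha + 1)); then n times the squared target radius
    exceeds every multiple of X ln n.  Matching the first m ~ X coefficients shows
    that the prior is uniformly X^(-alpha)-close to f0 on [0, 1] with probability at
    least exp(- C X ln n), and by Cauchy-Schwarz the evidence is bounded below as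
    soon as the mean inverse likelihood ratio over that neighbourhood is bounded
    above.  More than D X terms, or a coefficient beyond a power of n, have prior
    probability at most exp(- C' X ln n) with C' as large as desired.  Apart from
    these events the coefficients are covered by exp(O(X ln n)) grid cells; for a
    cell whose centre differs from f0 by p, the likelihood ratio is compared with
    the square root of its value at the centre, and the error is the n-th power
    of the affinity int exp(- p^2 / (16 sigma^2)).

    Bounding that affinity by the L2 norm of p requires that p^2 not concentrate
    on a very small set.  A trigonometric polynomial of degree m with polynomially
    bounded coefficients is, at its maximum, nearly constant on an interval of
    length 1/L with L ~ m n^kappa: otherwise Landau's inequality
    sup |p'|^2 <= C sup |p| sup |p''| would propagate the fast variation to higher
    derivatives, contradicting the trivial bound on their size.  The affinity is
    thus at most exp(- c / L) even when p is unbounded, and n / L dominates X ln n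
    precisely because alpha > 1/2. *)

Require Import Defs.
From HB Require Import structures.
From mathcomp Require Import all_boot all_order all_algebra.
From mathcomp Require Import all_classical all_reals all_analysis.
From mathcomp Require Import measurable_realfun zify ring lra.

Set Implicit Arguments.
Unset Strict Implicit.
Unset Printing Implicit Defensive.

Import Order.TTheory GRing.Theory Num.Theory.
Import numFieldNormedType.Exports.

Local Open Scope classical_set_scope.
Local Open Scope ring_scope.

(** * Landau inequality and affinities of trigonometric polynomials *)

Section nikolskii.
Context (R : realType).

Lemma is_derive_continuous (f df : R -> R) :
  (forall z, is_derive z (1 : R) f (df z)) -> continuous f.
Proof.
by move=> fd z; apply/differentiable_continuous/derivable1_diffP; case: (fd z).
Qed.

Lemma derive_MVT (f df : R -> R) (x y : R) :
  (forall z, is_derive z (1 : R) f (df z)) -> 0 <= x <= 1 -> 0 <= y <= 1 ->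
  exists c, [/\ 0 <= c <= 1, f y - f x = df c * (y - x),
    `|x - c| <= `|y - x| & `|c - y| <= `|y - x|].
Proof.
move=> fd.
have fc a b : {within `[a, b], continuous f}.
  exact/continuous_subspaceT/(is_derive_continuous fd).
wlog xy : x y / x <= y => [wh x01 y01|/andP[x0 x1] /andP[y0 y1]].
  have [xy|/ltW yx] := leP x y; first exact: wh.
  have [c [c01 e lx ly]] := wh y x yx y01 x01.
  exists c; split => //; first by rewrite -opprB e -mulrN opprB.
    by rewrite distrC (distrC y x).
  by rewrite distrC (distrC y x).
have [c] := MVT_segment xy (fun z _ => fd z) (fc x y).
rewrite in_itv/= => /andP[xc cy] e; exists c; split => //; first lra.
  by rewrite distrC !ger0_norm ?subr_ge0//; lra.
by rewrite distrC !ger0_norm ?subr_ge0//; lra.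
Qed.

(** From [x] move by [s = 4 * S0 / S1] in a direction that stays in [0, 1]; [8 * S0 <= S1] gives
    [s <= 1/2], so there is one. The mean slope of [f] on the way is at most [2 * S0 / s = S1 / 2],
    so [f1] loses [S1 / 2] within distance [s], whence [S2 * s >= S1 / 2]. *)
Lemma landau_inequality (f f1 f2 : R -> R) (S0 S1 S2 x : R) :
  (forall z, is_derive z (1 : R) f (f1 z)) ->
  (forall z, is_derive z (1 : R) f1 (f2 z)) ->
  0 <= x <= 1 -> `|f1 x| = S1 ->
  (forall z, 0 <= z <= 1 -> `|f z| <= S0) ->
  (forall z, 0 <= z <= 1 -> `|f2 z| <= S2) ->
  0 < S0 -> 8 * S0 <= S1 -> S1 ^+ 2 <= 8 * S0 * S2.
Proof.
move=> fd f1d x01 fx b0 b2 S0_gt0 S01.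
have S1_gt0 : 0 < S1 by lra.
pose s := 4 * S0 / S1.
have s0 : 0 < s by rewrite /s divr_gt0// mulr_gt0.
have s2 : s <= 2^-1 by rewrite /s ler_pdivrMr//; lra.
have [y y01 ys] : exists2 y, 0 <= y <= 1 & `|y - x| = s.
  have [xl|xl] := leP x 2^-1.
    exists (x + s); first by case/andP: x01 => ? ?; lra.
    by rewrite addrC addKr gtr0_norm.
  exists (x - s); first by case/andP: x01 => ? ?; lra.
  by rewrite addrC addKr normrN gtr0_norm.
have [c [c01 ce cx _]] := derive_MVT fd x01 y01.
have [c' [c'01 c'e _ _]] := derive_MVT f1d c01 x01.
have e1 : `|f1 c| * s <= 2 * S0.
  rewrite -ys -normrM -ce (le_trans (ler_normB _ _))//.
  by have := b0 _ y01; have := b0 _ x01; lra.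
have e2 : S1 <= `|f1 c| + S2 * s.
  rewrite -fx -[f1 x](subrK (f1 c)) addrC (le_trans (ler_normD _ _))// lerD2l.
  by rewrite c'e normrM ler_pM// ?b2// -ys.
have sS : S1 * s = 4 * S0 by rewrite /s mulrC divfK ?gt_eqF.
have e3 : 2 * S0 <= S2 * s ^+ 2.
  have : S1 * s <= (`|f1 c| + S2 * s) * s by rewrite ler_pM2r.
  by rewrite sS expr2 mulrDl mulrA; lra.
have : 2 * S0 * S1 ^+ 2 <= S2 * s ^+ 2 * S1 ^+ 2 by rewrite ler_pM2r// exprn_gt0.
rewrite -[S2 * _ * _]mulrA -exprMn (mulrC s) sS => e4.
rewrite -(ler_pM2l (_ : 0 < 2 * S0)); last by rewrite mulr_gt0.
by rewrite (le_trans e4)// le_eqVlt; apply/orP; left; apply/eqP; ring.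
Qed.

Lemma norm_max (f : R -> R) : continuous f ->
  exists2 c, 0 <= c <= 1 & forall z, 0 <= z <= 1 -> `|f z| <= `|f c|.
Proof.
move=> fc; have /= := @EVT_max R (fun z => `|f z|) 0 1 ler01.
case; first by apply: continuous_subspaceT => z; apply: cvg_norm; exact: fc.
move=> c c01 cm; exists c => [|z z01]; first by rewrite in_itv/= in c01.
by apply: cm; rewrite in_itv.
Qed.

(* If F 0 varied faster than L at its maximum, Landau's inequality would
   propagate the growth ratio, up to a factor 8 each time, to the D-th
   derivative. *)
Lemma slow_variation (F : nat -> R -> R) (D : nat) (L : R) (x0 : R) :
  (forall i z, is_derive z (1 : R) (F i) (F i.+1 z)) ->
  8 ^+ D.+1 <= L -> 0 <= x0 <= 1 ->
  (forall z, 0 <= z <= 1 -> `|F 0%N z| <= `|F 0%N x0|) ->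
  0 < `|F 0%N x0| ->
  (forall z, 0 <= z <= 1 -> `|F D z| < `|F 0%N x0| * (L / 8 ^+ D) ^+ D) ->
  forall z, 0 <= z <= 1 -> `|F 1%N z| <= L * `|F 0%N x0|.
Proof.
move=> Fd L8 x01 x0max x0gt FD z z01.
have L0 : 0 < L by apply: lt_le_trans L8; rewrite exprn_gt0.
rewrite leNgt; apply/negP => zL.
have Fc i : continuous (F i) by exact: is_derive_continuous (Fd i).
have [c] := choice (fun i => (let: ex_intro2 c a b := norm_max (@Fc i) in
  ex_intro (fun c => 0 <= c <= 1 /\ forall z, 0 <= z <= 1 -> `|F i z| <= `|F i c|)
   c (conj a b))).
move=> cP; pose S i := `|F i (c i)|.
have S0E : S 0%N = `|F 0%N x0|.
  by apply/le_anti/andP; split; [apply: x0max|apply (cP 0%N).2]=> //; case: (cP 0%N).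
(* Landau's inequality for three consecutive suprema costs a factor 8 in the ratio; [8 ^+ D.+1 <= L]
   keeps every ratio at least 8, so that it applies again. *)
have key i : (i < D)%N -> 0 < S i /\ L / 8 ^+ i * S i <= S i.+1.
  elim: i => [_|i IH iD].
    by rewrite S0E; split => //; rewrite expr0 divr1 (le_trans (ltW zL))//; apply (cP 1%N).2.
  have [Si0 Si1] := IH (ltnW iD).
  have h8 : 8 <= L / 8 ^+ i.
    rewrite ler_pdivlMr ?exprn_gt0// -exprS (le_trans _ L8)//.
    by rewrite ler_weXn2l ?ltnS ?(ltnW (ltnW iD))// ler1n.
  have Si8 : 8 * S i <= S i.+1 by rewrite (le_trans _ Si1)// ler_pM2r.
  have Si10 : 0 < S i.+1 by apply: lt_le_trans Si8; rewrite mulr_gt0.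
  split => //.
  have := @landau_inequality _ _ _ (S i) (S i.+1) (S i.+2) (c i.+1) (Fd i) (Fd i.+1)
     (cP _).1 erefl (cP _).2 (cP _).2 Si0 Si8.
  have := ler_wpM2r (ltW Si10) Si1; rewrite expr2 => h1 h2.
  have h3 := le_trans h1 h2.
  rewrite -(ler_pM2l (_ : 0 < 8 * S i)) ?mulr_gt0//.
  apply: le_trans h3; rewrite le_eqVlt; apply/orP; left; apply/eqP.
  by rewrite exprS invfM; field; rewrite expf_neq0.
have : S D >= S 0%N * (L / 8 ^+ D) ^+ D.
  have gen i : (i <= D)%N -> S 0%N * (L / 8 ^+ D) ^+ i <= S i.
    elim: i => [|i IH] iD; first by rewrite expr0 mulr1.
    have [Si0 Si1] := key _ iD.
    apply: le_trans Si1; rewrite exprS mulrCA ler_pM ?IH// 1?ltnW//.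
    - by rewrite divr_ge0 ?exprn_ge0// ltW.
    - by rewrite S0E mulr_ge0// exprn_ge0// divr_ge0 ?exprn_ge0// ltW.
    - by rewrite ler_pM2l// lef_pV2 ?posrE ?exprn_gt0// ler_weXn2l ?ler1n// ltnW.
  exact: gen.
by rewrite leNgt S0E FD//; case: (cP D).
Qed.

(** By the mean value theorem [|F|] stays above half of [|F x0|] on an interval of length
    [1 / (2 * L)] with an endpoint at [x0]. *)
Lemma integral_sqr_ge (F F1 : R -> R) (L : R) (x0 : R) :
  (forall z, is_derive z (1 : R) F (F1 z)) -> 1 <= L -> 0 <= x0 <= 1 ->
  (forall z, 0 <= z <= 1 -> `|F1 z| <= L * `|F x0|) ->
  ((`|F x0| ^+ 2 / (8 * L))%:E <=
    \int[@lebesgue_measure R]_(x in `[0%R, 1%R]) ((F x) ^+ 2)%:E)%E.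
Proof.
move=> Fd L1 x01 F1L.
have L0 : 0 < L by lra.
have L20 : 0 < (2 * L)^-1 by rewrite invr_gt0 mulr_gt0.
have L21 : (2 * L)^-1 <= 2^-1 by rewrite lef_pV2 ?posrE// ?mulr_gt0// ler_peMr.
have [a [a0 a1 an]] : exists a, [/\ 0 <= a, a + (2 * L)^-1 <= 1 &
    forall z, a <= z <= a + (2 * L)^-1 -> `|z - x0| <= (2 * L)^-1].
  case/andP: x01 => x00 x01; have [xl|xl] := leP x0 2^-1.
    by exists x0; split => [||z]; [lra|lra|move=> ?; rewrite ler_norml; lra].
  by exists (x0 - (2 * L)^-1); split => [||z]; [lra|lra|move=> ?; rewrite ler_norml; lra].
have Fm : measurable_fun setT F.
  by apply: continuous_measurable_fun; exact: (is_derive_continuous Fd).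
have sub : `[a, a + (2 * L)^-1] `<=` `[0, 1].
  by move=> z /=; rewrite !in_itv/= => ?; lra.
apply: (@le_trans _ _ (\int[@lebesgue_measure R]_(x in `[a, (a + (2 * L)^-1)%R])
    ((F x) ^+ 2)%:E)%E); last first.
  apply: ge0_subset_integral => //=.
    by apply/measurable_EFinP; apply: measurable_funX; exact: measurable_funTS.
  by move=> x _; rewrite lee_fin sqr_ge0.
apply: (@le_trans _ _ (\int[@lebesgue_measure R]_(x in `[a, (a + (2 * L)^-1)%R])
    ((`|F x0| / 2) ^+ 2)%:E)%E).
  rewrite integral_cst//= lebesgue_measure_itv/= lte_fin ltrDl L20 -EFinB -EFinM.
  rewrite lee_fin addrC addKr le_eqVlt; apply/orP; left; apply/eqP.
  by field; rewrite gt_eqF.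
apply: ge0_le_integral => //=.
  by apply/measurable_EFinP; apply: measurable_funX; exact: measurable_funTS.
move=> z; rewrite in_itv/= => za; rewrite lee_fin -(real_normK (num_real (F z))).
rewrite ler_pXn2r ?nnegrE// ?divr_ge0//.
have z01 : 0 <= z <= 1 by lra.
have [c [c01 ce _ _]] := derive_MVT Fd x01 z01.
have : `|F x0| - `|F z| <= `|F x0| / 2; last lra.
have := lerB_dist (F x0) (F z); rewrite distrC ce normrM => /le_trans; apply.
apply: (@le_trans _ _ (L * `|F x0| * (2 * L)^-1)).
  by rewrite ler_pM// ?F1L ?an.
by rewrite le_eqVlt; apply/orP; left; apply/eqP; field; rewrite gt_eqF.
Qed.

End nikolskii.

Section trigonometric_polynomials.
Context (R : realType).

Definition freq (k : nat) : R := k./2%:R * pi.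

Definition phase (k : nat) : R := if odd k then 0 else - (pi / 2).

(** The [i]-th derivative of the sum of [c k * psi k]: with sines written as cosines of phase
    [- pi / 2], differentiation multiplies by the frequency and advances the phase by [pi / 2]. *)
Definition tpoly (c : nat -> R) (m i : nat) (x : R) : R :=
  \sum_(1 <= k < m.+1)
    c k * freq k ^+ i * cos (freq k * x + phase k + i%:R * (pi / 2)).

Lemma psiE k x : psi k x = cos (freq k * x + phase k).
Proof.
rewrite /psi /freq /phase; case: eqP => [->|_] /=.
  by rewrite mul0r mul0r addr0 cos0.
by case: ifP => _; rewrite ?addr0// -[LHS]cosBpihalf.
Qed.

Lemma tpolyE c m x : tpoly c m 0 x = \sum_(1 <= k < m.+1) c k * psi k x.
Proof. by apply: eq_bigr => k _; rewrite psiE expr0 mulr1 mul0r addr0. Qed.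

Lemma is_derive_tpoly c m i x :
  is_derive x (1 : R) (tpoly c m i) (tpoly c m i.+1 x).
Proof.
rewrite /tpoly; elim: m => [|m IH].
  rewrite big_geq// (_ : (fun _ => _) = cst 0); last first.
    by apply/funext => y; rewrite big_geq.
  exact: is_derive_cst.
rewrite big_nat_recr//= (_ : (fun _ => _) = (fun y => \sum_(1 <= k < m.+1)
    c k * freq k ^+ i * cos (freq k * y + phase k + i%:R * (pi / 2))) +
  (fun y => c m.+1 * freq m.+1 ^+ i *
      cos (freq m.+1 * y + phase m.+1 + i%:R * (pi / 2)))); last first.
  by apply/funext => y; rewrite big_nat_recr.
apply: is_deriveD.
set a := freq _; set b := phase _.
apply: is_derive_eq.
have -> : i.+1%:R * (pi / 2) = i%:R * (pi / 2) + pi / 2 :> R.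
  by rewrite -[i.+1]addn1 natrD; ring.
rewrite addrA cosDpihalf exprSr /GRing.scale/=; ring.
Qed.

Lemma tpoly_le (c : nat -> R) (m i : nat) (x B : R) : 0 <= B -> (forall k, (1 <= k
    <= m)%N -> `|c k| <= B) ->
  `|tpoly c m i x| <= m%:R * B * (m%:R * pi) ^+ i.
Proof.
move=> B0 cB; rewrite (le_trans (ler_norm_sum _ _ _))//.
apply: (@le_trans _ _ (\sum_(1 <= k < m.+1) B * (m%:R * pi) ^+ i)).
  apply: ler_sum_nat => k km; rewrite !normrM -[leRHS]mulr1.
  rewrite ler_pM ?mulr_ge0// ?cos_max//.
  rewrite ler_pM ?cB// normrX lerXn2r ?nnegrE//.
    by rewrite mulr_ge0 ?pi_ge0.
  rewrite /freq ger0_norm ?mulr_ge0 ?pi_ge0// ler_wpM2r ?pi_ge0// ler_nat.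
  by case/andP: km => _ km; rewrite -ltnS (leq_ltn_trans _ km)// leq_half_double
      -addnn leqW// leq_addl.
by rewrite sumr_const_nat subn1 -[leLHS]mulr_natl mulrA.
Qed.

Lemma continuous_tpoly c m i : continuous (tpoly c m i).
Proof. exact: is_derive_continuous (is_derive_tpoly c m i). Qed.

Lemma expRN_le (u : R) : 0 <= u <= 1 -> expR (- u) <= 1 - u / 2.
Proof.
move=> /andP[u0 u1]; rewrite expRN -div1r ler_pdivrMr ?expR_gt0//.
apply: (@le_trans _ _ ((1 - u / 2) * (1 + u))).
  by have : 0 <= u * (1 - u) by [rewrite mulr_ge0// subr_ge0]; lra.
by rewrite ler_wpM2l ?expR_ge1Dx//; lra.
Qed.

(** Where [p ^+ 2 <= K] the exponential lies below [1 - u / 2], so the integral sees the L2 norm of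
    [p]; [1 - y <= exp (- y)] restores the exponential form. *)
Lemma integral_expRN_le (p : R -> R) (K V : R) : measurable_fun setT p -> 0 < K ->
  (forall x, 0 <= x <= 1 -> p x ^+ 2 <= K) ->
  (V%:E <= \int[@lebesgue_measure R]_(x in `[0%R, 1%R]) (p x ^+ 2)%:E)%E ->
  (\int[@lebesgue_measure R]_(x in `[0%R, 1%R]) (expR (- (p x ^+ 2 / K)))%:E <=
    (expR (- (V / (2 * K))))%:E)%E.
Proof.
move=> mp K0 pK Vp.
set I := (\int[_]_(_ in _) _)%E.
have mpT (D : set R) : measurable_fun D p by exact: measurable_funTS.
have mp2 : measurable_fun (`[0%R, 1%R]%classic : set R) (fun x => (p x ^+ 2)%:E).
  by apply/measurable_EFinP; exact: measurable_funX.
have me : measurable_fun (`[0%R, 1%R]%classic : set R) (fun x => (expR (- (p x ^+ 2 / K)))%:E).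
  apply/measurable_EFinP/measurableT_comp => //; apply: measurableT_comp => //.
  by apply: measurable_funM => //; exact: measurable_funX.
have I1 : (I + (2 * K)^-1%:E * V%:E <= 1)%E.
  apply: (@le_trans _ _ (I + (2 * K)^-1%:E *
      \int[@lebesgue_measure R]_(x in `[0%R, 1%R]) (p x ^+ 2)%:E)%E).
    by rewrite leeD2l// lee_wpmul2l// lee_fin invr_ge0 mulr_ge0// ltW.
  rewrite -ge0_integralZl//=; last 2 first.
    by move=> x _; rewrite lee_fin sqr_ge0.
    by rewrite lee_fin invr_ge0 mulr_ge0// ltW.
  rewrite /I -ge0_integralD//=; last 2 first.
    by move=> x _; rewrite mule_ge0// lee_fin ?sqr_ge0// invr_ge0 mulr_ge0// ltW.
    exact: measurable_funeM.
  apply: (@le_trans _ _ (\int[@lebesgue_measure R]_(x in `[0%R, 1%R]) (cst 1%E) x)%E).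
    apply: ge0_le_integral => //=.
    - by move=> x _; rewrite adde_ge0 ?mule_ge0// lee_fin ?expR_ge0 ?sqr_ge0//
        invr_ge0 mulr_ge0// ltW.
    - by apply: emeasurable_funD => //; exact: measurable_funeM.
    - move=> x; rewrite in_itv/= => x01; rewrite -EFinM -EFinD lee_fin.
      have := @expRN_le (p x ^+ 2 / K); rewrite divr_ge0 ?sqr_ge0 ?(ltW K0)//=.
      rewrite ler_pdivrMr// mul1r pK// => /(_ isT).
      rewrite (_ : (2 * K)^-1 * p x ^+ 2 = p x ^+ 2 / K / 2); first lra.
      by field; rewrite gt_eqF.
  by rewrite integral_cst//= lebesgue_measure_itv/= lte_fin ltr01 oppr0 adde0 mule1.
have I0 : (0 <= I)%E by apply: integral_ge0 => x _; rewrite lee_fin expR_ge0.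
apply: (@le_trans _ _ (1 - V / (2 * K))%:E); last first.
  by rewrite lee_fin (le_trans _ (expR_ge1Dx _)).
by rewrite EFinB leeBrDr// (le_trans _ I1)// leeD2l// -EFinM mulrC.
Qed.

(* The frequencies are at most m pi, so a polynomial p with coefficients of
   size B cannot concentrate its L2-mass on an interval much shorter than 1 / L
   unless it is small. *)
Lemma affinity_bound (c : nat -> R) (m D : nat) (B K0 L V : R) :
  (forall k, (1 <= k <= m)%N -> `|c k| <= B) -> 0 <= B -> 0 < K0 ->
  8 ^+ D.+1 <= L ->
  m%:R * B * (m%:R * pi) ^+ D < Num.sqrt K0 * (L / 8 ^+ D) ^+ D ->
  (V%:E <= \int[@lebesgue_measure R]_(x in `[0%R, 1%R]) (tpoly c m 0 x ^+ 2)%:E)%E ->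
  (\int[@lebesgue_measure R]_(x in `[0%R, 1%R]) (expR (- (tpoly c m 0 x ^+ 2 / K0)))%:E <=
    (expR (- (Num.min (V / K0) (8 * L)^-1 / 2)))%:E)%E.
Proof.
move=> cB B0 K00 L8 BL VI.
set p := tpoly c m 0.
have mp : measurable_fun setT p.
  by apply: continuous_measurable_fun; exact: continuous_tpoly.
have L0 : 0 < L by apply: lt_le_trans L8; rewrite exprn_gt0.
have L1 : 1 <= L by apply: le_trans L8; rewrite exprn_ege1// ler1n.
have [x0 x001 x0max] := norm_max (@continuous_tpoly c m 0).
(* Below the level [K0] the linearised exponential gives the first entry of the minimum; above it,
   slow variation near the maximum gives the second. *)
have [S|S] := leP (`|p x0| ^+ 2) K0.
  apply: (@le_trans _ _ (expR (- (V / (2 * K0))))%:E).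
    apply: integral_expRN_le => // x x01; apply: le_trans S.
    rewrite -(real_normK (num_real (p x))) ler_pXn2r ?nnegrE//; exact: x0max.
  have -> : V / (2 * K0) = V / K0 / 2 by field; rewrite gt_eqF.
  by rewrite lee_fin ler_expR lerN2 ler_wpM2r ?invr_ge0// ge_min lexx.
have px0 : 0 < `|p x0|.
  rewrite lt_neqAle normr_ge0 andbT eq_sym.
  by apply: contraTN S => /eqP ->; rewrite expr0n /= -leNgt ltW.
have sK : Num.sqrt K0 < `|p x0|.
  by rewrite -(ger0_norm (ltW px0)) -sqrtr_sqr ltr_sqrt// exprn_gt0.
(* Since [|p x0|] exceeds the root of [K0], the trivial bound on the [D]-th derivative falls under
   the growth that fast variation would force. *)
have Fb z : 0 <= z <= 1 -> `|tpoly c m D z| < `|tpoly c m 0 x0| * (L / 8 ^+ D) ^+ D.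
  move=> _; rewrite (le_lt_trans (tpoly_le _ _ B0 cB))// (lt_trans BL)//.
  by rewrite ltr_pM2r// exprn_gt0// divr_gt0// exprn_gt0.
have slow := slow_variation (is_derive_tpoly c m) L8 x001 x0max px0 Fb.
have V' := integral_sqr_ge (is_derive_tpoly c m 0) L1 x001 slow.
have S0 : 0 < `|p x0| ^+ 2 by rewrite exprn_gt0.
(* Enlarging the denominator from [K0] to [|p x0| ^+ 2] raises the integrand and puts the exponent
   in the range of the linear bound; the size of the maximum then cancels. *)
apply: (@le_trans _ _ (\int[@lebesgue_measure R]_(x in `[0%R, 1%R])
    (expR (- (p x ^+ 2 / `|p x0| ^+ 2)))%:E)%E).
  apply: ge0_le_integral => //=.
  - apply/measurable_EFinP/measurableT_comp => //; apply: measurableT_comp => //.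
    by apply: measurable_funM => //; apply: measurable_funX; exact: measurable_funTS.
  - apply/measurable_EFinP/measurableT_comp => //; apply: measurableT_comp => //.
    by apply: measurable_funM => //; apply: measurable_funX; exact: measurable_funTS.
  move=> x _; rewrite lee_fin ler_expR lerN2 ler_wpM2l ?sqr_ge0//.
  by rewrite lef_pV2 ?posrE// ltW.
apply: (le_trans (integral_expRN_le mp S0 _ V')) => [x x01|].
  rewrite -(real_normK (num_real (p x))) ler_pXn2r ?nnegrE//; exact: x0max.
have -> : `|p x0| ^+ 2 / (8 * L) / (2 * `|p x0| ^+ 2) = (8 * L)^-1 / 2.
  by field; rewrite !gt_eqF.
by rewrite lee_fin ler_expR lerN2 ler_wpM2r ?invr_ge0// ge_min lexx orbT.
Qed.

End trigonometric_polynomials.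

(** * Products of i.i.d. observations *)

Section iid.
Context (R : realType).

Lemma measurable_prod_tnth d (T : measurableType d) n (phi : nat -> T -> R) :
  (forall i, measurable_fun setT (phi i)) ->
  measurable_fun setT (fun w : n.-tuple T => \prod_(i < n) phi i (tnth w i)).
Proof.
move=> mphi; apply: measurable_prod => i _.
by apply: measurableT_comp => //; exact: measurable_tnth.
Qed.

(** Tonelli, one coordinate at a time. The factors may depend on the index: this isolates one
    coordinate in [iid_tnth] and allows a different interval per coefficient in [prior_box_ge]. *)
Lemma integral_iid_prod d (T : measurableType d) (P : probability T R) n
    (phi : nat -> T -> R) (r : nat -> R) :
  (forall i, measurable_fun setT (phi i)) -> (forall i x, 0 <= phi i x) ->
  (forall i, \int[P]_x (phi i x)%:E = (r i)%:E)%E ->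
  (\int[iid P n]_w (\prod_(i < n) phi i (tnth w i))%:E = (\prod_(i < n) r i)%:E)%E.
Proof.
elim: n phi r => [|n IH] phi r mphi phi0 phir.
  rewrite big_ord0 (eq_integral (cst 1%E)); last by move=> x _; rewrite big_ord0.
  by rewrite integral_cst// mul1e; exact: (probability_setT (iid P 0)).
rewrite /= ge0_integral_pushforward//=; first last.
  by move=> x _; rewrite lee_fin prodr_ge0.
  by apply/measurable_EFinP; exact: measurable_prod_tnth.
rewrite fubini_tonelli1//=; last 2 first.
  apply/measurable_EFinP.
  apply: (measurableT_comp (@measurable_prod_tnth _ T n.+1 phi mphi)).
  exact: measurable_consp.
  by move=> x; rewrite lee_fin prodr_ge0.
rewrite /fubini_F/=.
have E x : (\int[iid P n]_y (\prod_(i < n.+1) phi i (tnth (consp (x, y)) i))%:E =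
    (phi 0%N x)%:E * (\prod_(i < n) r i.+1)%:E)%E.
  rewrite (eq_integral (fun y : n.-tuple T =>
      (phi 0%N x)%:E * (\prod_(i < n) phi i.+1 (tnth y i))%:E)%E); last first.
    move=> y _; rewrite big_ord_recl EFinM; congr (_ * _)%E.
    by congr EFin; apply: eq_bigr => i _; rewrite !(tnth_nth x).
  rewrite ge0_integralZl//=; last 3 first.
    apply/measurable_EFinP.
    exact: (@measurable_prod_tnth _ T n (fun i => phi i.+1)).
    by move=> y _; rewrite lee_fin prodr_ge0.
    by rewrite lee_fin.
  by rewrite (IH (fun i => phi i.+1) (fun i => r i.+1)).
under eq_integral do rewrite E.
rewrite ge0_integralZr//=.
- by rewrite phir big_ord_recl EFinM.
- exact/measurable_EFinP.
- by move=> x _; rewrite lee_fin.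
- rewrite lee_fin prodr_ge0// => i _.
  by rewrite -lee_fin -phir integral_ge0// => x _; rewrite lee_fin.
Qed.

Lemma integral_iid_expn_le d (T : measurableType d) (P : probability T R) n
    (phi : T -> R) (r : R) :
  measurable_fun setT phi -> (forall x, 0 <= phi x) ->
  (\int[P]_x (phi x)%:E <= r%:E)%E ->
  (\int[iid P n]_w (\prod_(i < n) phi (tnth w i))%:E <= (r ^+ n)%:E)%E.
Proof.
move=> mphi phi0 phir.
have I0 : (0 <= \int[P]_x (phi x)%:E)%E by apply: integral_ge0 => x _; rewrite lee_fin.
have If : (\int[P]_x (phi x)%:E)%E \is a fin_num by rewrite ge0_fin_numE//
    (le_lt_trans phir)// ltry.
rewrite (@integral_iid_prod _ _ _ n (fun=> phi) (fun=> fine (\int[P]_x (phi x)%:E)))//; last first.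
  by move=> _; rewrite fineK.
rewrite lee_fin prodr_const card_ord lerXn2r ?nnegrE ?fine_ge0//.
  by rewrite -lee_fin (le_trans I0).
by rewrite -lee_fin fineK.
Qed.

Lemma iid_tnth d (T : measurableType d) (P : probability T R) n (i : 'I_n) (A : set T) :
  measurable A -> iid P n [set w | A (tnth w i)] = P A.
Proof.
move=> mA.
have mS : measurable [set w : n.-tuple T | A (tnth w i)].
  by rewrite -[X in measurable X]setTI; exact: measurable_tnth.
rewrite -(setIT [set w | _]) -(@integral_indic _ _ _ (iid P n) setT)//=.
pose phi (k : nat) : T -> R := if k == i then \1_A else cst 1.
have mphi k : measurable_fun setT (phi k).
  by rewrite /phi; case: ifP => _; [exact: measurable_indic|exact: measurable_cst].
have phi0 k x : 0 <= phi k x by rewrite /phi; case: ifP.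
have PA : P A \is a fin_num by exact: fin_num_measure.
have Ir k : (\int[P]_x (phi k x)%:E = (if k == i then fine (P A) else 1)%:E)%E.
  rewrite /phi; case: ifP => _; first by rewrite integral_indic// setIT fineK.
  by rewrite (eq_integral (cst 1%E))// integral_cst// mul1e; exact: probability_setT.
transitivity (\int[iid P n]_w (\prod_(k < n) phi k (tnth w k))%:E)%E.
  apply: eq_integral => w _; congr EFin.
  rewrite (bigD1 i)//= /phi eqxx big1 ?mulr1//.
  by move=> j; rewrite -val_eqE => /negbTE ->.
rewrite (integral_iid_prod n mphi phi0 Ir) (bigD1 i)//= eqxx big1 ?mulr1 ?fineK//.
by move=> j; rewrite -val_eqE => /negbTE ->.
Qed.

End iid.

Section gaussian.
Context (R : realType) (sigma : R).
Hypothesis sigma_gt0 : 0 < sigma.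

Lemma normal_pdf_shift (a x : R) :
  expR (a * x) * normal_pdf 0 sigma x =
  expR (a ^+ 2 * sigma ^+ 2 / 2) * normal_pdf (a * sigma ^+ 2) sigma x.
Proof.
rewrite !normal_pdfE ?gt_eqF// /normal_fun mulrCA [RHS]mulrCA -!expRD.
by congr (_ * expR _); field; rewrite gt_eqF.
Qed.

(** The Radon-Nikodym derivative of [normal_prob] has the same integrals as [normal_pdf] over
    measurable sets, hence agrees with it almost everywhere. *)
Lemma integral_normal_prob (f : R -> \bar R) :
  measurable_fun setT f -> (forall x, 0 <= f x)%E ->
  (\int[normal_prob 0 sigma]_x f x =
   \int[lebesgue_measure]_x (f x * (normal_pdf 0 sigma x)%:E))%E.
Proof.
move=> mf f0.
have dom := normal_prob_dominates 0 sigma.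
rewrite -(Radon_Nikodym_SigmaFinite.change_of_variables dom)//.
have mRN := Radon_Nikodym_SigmaFinite.f_integrable dom.
have mpdf : measurable_fun setT (fun x : R => (normal_pdf 0 sigma x)%:E).
  by apply/measurable_EFinP; exact: measurable_normal_pdf.
apply: ae_eq_integral => //.
- by apply: emeasurable_funM => //; exact: measurable_int mRN.
- exact: emeasurable_funM.
apply: ae_eqe_mul2l; apply: integral_ae_eq => //= E _ mE.
by rewrite -(Radon_Nikodym_SigmaFinite.f_integral dom).
Qed.

(** Completing the square turns the tilted density into a multiple of a shifted normal density,
    whose mass is 1. *)
Lemma normal_mgf (a : R) :
  (\int[normal_prob 0 sigma]_x (expR (a * x))%:E =
   (expR (a ^+ 2 * sigma ^+ 2 / 2))%:E)%E.
Proof.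
rewrite integral_normal_prob//; last by apply/measurable_EFinP/measurableT_comp.
under eq_integral do rewrite -EFinM normal_pdf_shift EFinM.
rewrite ge0_integralZl//=; first by rewrite integral_normal_pdf mule1.
- apply/measurable_EFinP; exact: measurable_normal_pdf.
- by move=> x _; rewrite lee_fin normal_pdf_ge0.
Qed.
End gaussian.

(** * A deterministic bound on the posterior *)

Section nonmeasurable_integral.
Context d (T : measurableType d) (R : realType) (mu : {measure set T -> \bar R}).
Local Open Scope ereal_scope.

(* No measurability: the integral is a supremum over simple functions. *)
Lemma ge0_le_integral_nonmeasurable (D : set T) (f g : T -> \bar R) :
  (forall x, D x -> 0 <= f x) -> (forall x, D x -> f x <= g x) ->
  \int[mu]_(x in D) f x <= \int[mu]_(x in D) g x.
Proof.
move=> f0 fg; rewrite [leLHS]integral_mkcond [leRHS]integral_mkcond.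
have fp x : 0 <= (f \_ D) x.
  by rewrite patchE; case: ifPn => // /set_mem; exact: f0.
have fgD x : (f \_ D) x <= (g \_ D) x.
  by rewrite !patchE; case: ifPn => // /set_mem; exact: fg.
rewrite !ge0_integralTE//; last by move=> x; exact: le_trans (fp x) (fgD x).
apply: le_ereal_sup => _ [h hf <-]; exists h => // x.
exact: le_trans (hf x) (fgD x).
Qed.

End nonmeasurable_integral.

Section bayes_bound.
Context d (U : measurableType d) (R : realType) (Pi : probability U R).
(** [lik] is the likelihood and [a] the likelihood ratio, proportional to it on the almost sure
    event [E]. [B] is a neighbourhood of the truth, [Fc] the complement of the sieve, the cells
    [C j] cover the rest of [A], [W j] is a reference weight for its cell and [t] a threshold for
    the evidence. *)
Variables (lik a : U -> R) (c K : R) (E A B Fc : set U) (J : finType).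
Variables (C : J -> set U) (W : J -> R) (t : R).
Hypotheses (lik_ge0 : forall b, 0 <= lik b) (lik_le : forall b, lik b <= c).
Hypotheses (K_gt0 : 0 < K) (ma : measurable_fun setT a) (a_gt0 : forall b, 0 < a b).
Hypothesis maV : measurable_fun setT (fun b => (a b)^-1).
Hypotheses (mE : measurable E) (E1 : Pi (~` E) = 0%E).
Hypothesis lik_a : forall b, E b -> lik b = K * a b.
Hypotheses (mB : measurable B) (BE : B `<=` E) (PB : (0 < Pi B)%E).
Hypotheses (mFc : measurable Fc) (mC : forall j, measurable (C j)).
Hypothesis A_sub : forall b, A b -> E b -> Fc b \/ exists j, C j b.
Hypotheses (W_gt0 : forall j, 0 < W j) (t_gt0 : 0 < t).

Local Open Scope ereal_scope.

Let maE (S : set U) : measurable_fun S (fun b => (a b)%:E).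
Proof. by apply/measurable_EFinP; exact: measurable_funTS. Qed.

Lemma numerator_le :
  \int[Pi]_(b in A) (lik b)%:E <=
  K%:E * (\int[Pi]_(b in Fc) (a b)%:E + \sum_(j : J) \int[Pi]_(b in C j) (a b)%:E).
Proof.
rewrite integral_mkcond.
pose f0 : U -> \bar R := (fun b => (a b)%:E) \_ Fc.
pose f1 j : U -> \bar R := (fun b => (a b)%:E) \_ (C j).
have f00 x : 0 <= f0 x by rewrite /f0 patchE; case: ifP => // _; rewrite lee_fin ltW.
have f10 j x : 0 <= f1 j x by rewrite /f1 patchE; case: ifP => // _; rewrite lee_fin ltW.
have mf0 : measurable_fun setT f0 by apply/(measurable_restrictT _ mFc).
have mf1 j : measurable_fun setT (f1 j) by apply/(measurable_restrictT _ (mC j)).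
pose g x := f0 x + \sum_(j : J) f1 j x.
have g0 x : 0 <= g x by rewrite /g adde_ge0// sume_ge0.
have mg : measurable_fun setT g.
  by apply: emeasurable_funD => //; exact: emeasurable_sum.
(* Off [E] the identity with [K * a] is lost; the dominating function is infinite there, at no cost
   since the set is null. *)
pose h : U -> \bar R := (cst +oo) \_ (~` E).
have h0 x : 0 <= h x by rewrite /h patchE; case: ifP => // _; rewrite leey.
have mh : measurable_fun setT h.
  by apply/(measurable_restrictT _ (measurableC mE)); exact: measurable_cst.
apply: (@le_trans _ _ (\int[Pi]_x (h x + K%:E * g x))).
  apply: ge0_le_integral_nonmeasurable => x _.
    by rewrite patchE; case: ifP => // _; rewrite lee_fin.
  rewrite patchE; case: ifPn => [/set_mem Ax|_]; last first.
    by rewrite adde_ge0// mule_ge0// lee_fin ltW.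
  have [Ex|nEx] := pselect (E x); last first.
    by rewrite /h patchE mem_set// addye ?leey// gt_eqF// (lt_le_trans ltNy0)//
        mule_ge0// lee_fin ltW.
  rewrite lik_a// EFinM -[leLHS]add0e leeD// lee_wpmul2l ?lee_fin ?(ltW K_gt0)//.
  have [Fx|[j Cx]] := A_sub Ax Ex; rewrite /g.
    by rewrite -[leLHS]adde0 leeD// ?sume_ge0// /f0 patchE mem_set.
  rewrite -[leLHS]add0e leeD// (bigD1 j)//= -[leLHS]adde0 leeD ?sume_ge0//.
  by rewrite /f1 patchE mem_set.
rewrite ge0_integralD//=; last 2 first.
  by move=> x _; rewrite mule_ge0// lee_fin ltW.
  exact: measurable_funeM.
rewrite -integral_mkcond null_set_integral//; last exact: measurableC.
rewrite add0e ge0_integralZl//= ?lee_fin ?(ltW K_gt0)//.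
rewrite lee_wpmul2l ?lee_fin ?(ltW K_gt0)// /g ge0_integralD//=; last 2 first.
  by move=> x _; rewrite sume_ge0.
  exact: emeasurable_sum.
rewrite ge0_integral_sum// -integral_mkcond leeD2l//.
by apply: lee_sum => j _; rewrite -integral_mkcond.
Qed.

Lemma denominator_ge :
  K%:E * \int[Pi]_(b in B) (a b)%:E <= \int[Pi]_b (lik b)%:E.
Proof.
rewrite -ge0_integralZl//=; last 2 first.
  by move=> x _; rewrite lee_fin ltW.
  by rewrite lee_fin ltW.
rewrite integral_mkcond; apply: ge0_le_integral_nonmeasurable => x _.
  by rewrite patchE; case: ifP => // _; rewrite -EFinM lee_fin mulr_ge0 ?ltW.
rewrite patchE; case: ifPn => [/set_mem Bx|_]; last by rewrite lee_fin.
by rewrite -EFinM lik_a//; exact: BE.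
Qed.

Lemma lik_integral_le (D : set U) : \int[Pi]_(b in D) (lik b)%:E <= c%:E.
Proof.
rewrite integral_mkcond -[c%:E]mule1 -(probability_setT Pi) -integral_cst//.
apply: ge0_le_integral_nonmeasurable => x _; rewrite patchE; case: ifP => // _.
  by rewrite lee_fin.
by rewrite lee_fin.
by rewrite lee_fin (le_trans _ (lik_le x)).
Qed.

Lemma lik_integral_fin (D : set U) : \int[Pi]_(b in D) (lik b)%:E \is a fin_num.
Proof.
rewrite ge0_fin_numE ?(le_lt_trans (lik_integral_le D)) ?ltry//.
by apply: integral_ge0 => x _; rewrite lee_fin.
Qed.

Lemma posterior_le1 :
  (fine (\int[Pi]_(b in A) (lik b)%:E) / fine (\int[Pi]_b (lik b)%:E) <= 1)%R.
Proof.
have n0 : (0 <= fine (\int[Pi]_(b in A) (lik b)%:E))%R.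
  by rewrite fine_ge0// integral_ge0// => x _; rewrite lee_fin.
have : (fine (\int[Pi]_(b in A) (lik b)%:E) <= fine (\int[Pi]_b (lik b)%:E))%R.
  rewrite fine_le ?lik_integral_fin// integral_mkcond.
  apply: ge0_le_integral_nonmeasurable => x _; rewrite patchE; case: ifP => // _;
  by rewrite lee_fin.
(* If the evidence is 0, the quotient is 0 by the convention on inverses. *)
have [->|n1] := eqVneq (fine (\int[Pi]_b (lik b)%:E)) 0%R.
  by rewrite invr0 mulr0.
move=> nd; rewrite ler_pdivrMr ?mul1r// lt_neqAle eq_sym n1.
exact: le_trans nd.
Qed.

(** Cauchy-Schwarz between [a] and its inverse on [B], in the form [2 <= z + 1 / z] with
    [z = (q / t) * a] and [q] the mass of [B]. Small evidence is thus charged to the mean inverse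
    ratio, whose expectation over the data can be bounded. *)
Lemma evidence_lower_bound : \int[Pi]_(b in B) (a b)%:E < t%:E ->
  1 <= (t / fine (Pi B) ^+ 2)%:E * \int[Pi]_(b in B) ((a b)^-1)%:E.
Proof.
move=> Dt; set D := \int[Pi]_(b in B) _ in Dt; set I := \int[Pi]_(b in B) _.
have PBf : Pi B \is a fin_num by exact: fin_num_measure.
set q := fine (Pi B).
have q0 : (0 < q)%R by rewrite -lte_fin fineK.
have D0 : 0 <= D by apply: integral_ge0 => x _; rewrite lee_fin ltW.
have I0 : 0 <= I by apply: integral_ge0 => x _; rewrite lee_fin invr_ge0 ltW.
have Df : D \is a fin_num by rewrite ge0_fin_numE// (lt_trans Dt)// ltry.
have mi : measurable_fun B (fun x => ((a x)^-1)%:E).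
  by apply/measurable_EFinP; apply: measurable_funTS.
have amgm : q%:E + q%:E <= (q / t)%:E * D + (t / q)%:E * I.
  rewrite /D /I -!ge0_integralZl//=; last 4 first.
    by move=> x _; rewrite lee_fin invr_ge0 ltW.
    by rewrite lee_fin divr_ge0// ltW.
    by move=> x _; rewrite lee_fin ltW.
    by rewrite lee_fin divr_ge0// ltW.
  rewrite -ge0_integralD//=; last 4 first.
    by move=> x _; rewrite mule_ge0// lee_fin ?divr_ge0// ltW.
    exact: measurable_funeM.
    by move=> x _; rewrite mule_ge0// lee_fin ?divr_ge0 ?invr_ge0// ltW.
    exact: measurable_funeM.
  rewrite fineK// -mule2n -mule_natl -integral_cst//=.
  apply: ge0_le_integral => //=.
    by apply: emeasurable_funD => //; exact: measurable_funeM.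
  move=> x _; rewrite -!EFinM -EFinD lee_fin.
  have z0 : (0 < q / t * a x)%R by rewrite mulr_gt0// divr_gt0.
  have -> : (t / q / a x = (q / t * a x)^-1)%R by field; rewrite !gt_eqF.
  rewrite -subr_ge0; move: (q / t * a x)%R z0 => z z0.
  have -> : (z + z^-1 - 2 = (z - 1) ^+ 2 / z)%R by field; rewrite gt_eqF.
  by rewrite divr_ge0 ?sqr_ge0// ltW.
have [Iy|If] := eqVneq I +oo.
  by rewrite Iy gt0_muley ?leey// lte_fin divr_gt0// exprn_gt0.
have {}If : I \is a fin_num by rewrite ge0_fin_numE// ltey.
move: amgm Dt; rewrite -(fineK Df) -(fineK If) -!EFinM -!EFinD !lee_fin lte_fin.
set D' := fine D; set I' := fine I => amgm Dt.
have h1 : (q / t * D' <= q)%R.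
  by rewrite mulrAC ler_pdivrMr// ler_wpM2l// ltW.
have h2 : (q <= t / q * I')%R by lra.
have -> : (t / q ^+ 2 * I' = t / q * I' / q)%R by field; rewrite gt_eqF.
by rewrite ler_pdivlMr// mul1r.
Qed.

(* At most one of the three regimes is nontrivial: small evidence, some
   W j >= 1, or all W j <= 1. *)
Lemma posterior_bound :
  (fine (\int[Pi]_(b in A) (lik b)%:E) / fine (\int[Pi]_b (lik b)%:E))%:E <=
  (t / fine (Pi B) ^+ 2)%:E * \int[Pi]_(b in B) ((a b)^-1)%:E +
  (t^-1%:E * \int[Pi]_(b in Fc) (a b)%:E +
   \sum_(j : J) ((W j)%:E + (t * W j)^-1%:E * \int[Pi]_(b in C j) (a b)%:E)).
Proof.
set post := (fine _ / fine _)%R.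
have ia0 (S : set U) : 0 <= \int[Pi]_(b in S) (a b)%:E.
  by apply: integral_ge0 => x _; rewrite lee_fin ltW.
have T1 : 0 <= (t / fine (Pi B) ^+ 2)%:E * \int[Pi]_(b in B) ((a b)^-1)%:E.
  rewrite mule_ge0//; first by rewrite lee_fin divr_ge0 ?sqr_ge0// ltW.
  by apply: integral_ge0 => x _; rewrite lee_fin invr_ge0 ltW.
have T2 : 0 <= t^-1%:E * \int[Pi]_(b in Fc) (a b)%:E.
  by rewrite mule_ge0// lee_fin invr_ge0 ltW.
have T3 j : 0 <= (W j)%:E + (t * W j)^-1%:E * \int[Pi]_(b in C j) (a b)%:E.
  by rewrite adde_ge0 ?mule_ge0// lee_fin ?invr_ge0 ?mulr_ge0// ltW.
have [Dt|tD] := ltP (\int[Pi]_(b in B) (a b)%:E) t%:E.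
  apply: (@le_trans _ _ 1); first by rewrite lee_fin posterior_le1.
  rewrite -[leLHS]adde0 leeD ?evidence_lower_bound// adde_ge0// sume_ge0//.
have [[j Wj]|nW] := pselect (exists j, (1 <= W j)%R).
  apply: (@le_trans _ _ 1); first by rewrite lee_fin posterior_le1.
  rewrite -[leLHS]add0e leeD// -[leLHS]add0e leeD// (bigD1 j)//= -[leLHS]adde0.
  rewrite leeD ?sume_ge0// -[leLHS]adde0 leeD//.
  by rewrite mule_ge0// lee_fin ?invr_ge0 ?mulr_ge0// ltW.
have W1 j : (W j <= 1)%R.
  by rewrite leNgt; apply/negP => /ltW Wj; apply: nW; exists j.
rewrite -[leLHS]add0e leeD//.
(* As [W j <= 1], the factor [t^-1] may be raised to [(t * W j)^-1]: it is the ratio divided by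
   [W j] that has a small expectation. *)
apply: (@le_trans _ _ (t^-1%:E * (\int[Pi]_(b in Fc) (a b)%:E +
    \sum_(j : J) \int[Pi]_(b in C j) (a b)%:E))); last first.
  rewrite ge0_muleDr ?sume_ge0// leeD2l// ge0_sume_distrr//.
  apply: lee_sum => j _; rewrite -[leLHS]add0e leeD ?lee_fin ?(ltW (W_gt0 j))//.
  rewrite lee_wpmul2r// lee_fin lef_pV2 ?posrE ?mulr_gt0//.
  by rewrite ler_piMr// ltW.
have Kt0 : (0 < K * t)%R by rewrite mulr_gt0.
have den : (K * t <= fine (\int[Pi]_b (lik b)%:E))%R.
  rewrite -lee_fin fineK ?lik_integral_fin// (le_trans _ denominator_ge)//.
  by rewrite EFinM lee_wpmul2l// lee_fin ltW.
apply: (@le_trans _ _ ((K * t)^-1%:E * \int[Pi]_(b in A) (lik b)%:E)).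
  rewrite -(fineK (lik_integral_fin A)) -EFinM lee_fin /post mulrC ler_wpM2r//.
    by rewrite fine_ge0// integral_ge0// => x _; rewrite lee_fin.
  by rewrite lef_pV2 ?posrE// (lt_le_trans Kt0).
apply: (le_trans (lee_wpmul2l _ numerator_le)).
  by rewrite lee_fin invr_ge0 ltW.
rewrite muleA -EFinM; have -> : ((K * t)^-1 * K = t^-1)%R by field; rewrite !gt_eqF.
by [].
Qed.

End bayes_bound.

(** * Gaussian design integrals *)

Section weights.
Context (R : realType) (sigma : R).
Hypothesis sigma_gt0 : 0 < sigma.
Notation obs := (measurableTypeR R * measurableTypeR R)%type.

(** With noise [e] and [h = f - f0], the likelihood ratio is the weight for [u = h] and
    [v = - (h ^+ 2 / 2)]. Products, inverses and square roots of weights are weights, so every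
    random quantity to be averaged has this form. *)
Definition weight (u v : R -> R) n (w : n.-tuple (R * R)) : R :=
  \prod_(i < n) expR ((u (tnth w i).1 * (tnth w i).2 + v (tnth w i).1) / sigma ^+ 2).

Lemma weight_gt0 u v n (w : n.-tuple (R * R)) : 0 < weight u v w.
Proof. by rewrite prodr_gt0// => i _; exact: expR_gt0. Qed.

Lemma weightM u v u' v' n (w : n.-tuple (R * R)) :
  weight u v w * weight u' v' w = weight (u \+ u') (v \+ v') w.
Proof.
rewrite /weight -big_split/=; apply: eq_bigr => i _; rewrite -expRD -mulrDl.
by rewrite /= [(u _ + _) * _]mulrDl addrACA.
Qed.

Lemma weightV u v n (w : n.-tuple (R * R)) :
  (weight u v w)^-1 = weight (\- u) (\- v) w.
Proof.
rewrite /weight -prodfV; apply: eq_bigr => i _; rewrite -expRN -mulNr.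
by rewrite /= opprD mulNr.
Qed.

Section design.
Variables (u v : R -> R).
Hypotheses (mu : measurable_fun setT u) (mv : measurable_fun setT v).

Let phi (z : obs) := expR ((u z.1 * z.2 + v z.1) / sigma ^+ 2).

Let mphi : measurable_fun setT phi.
Proof.
apply: measurableT_comp => //; apply: measurable_funM => //.
apply: measurable_funD; last exact: measurableT_comp.
by apply: measurable_funM => //; exact: measurableT_comp.
Qed.

Lemma measurable_weight n :
  measurable_fun setT (fun w : n.-tuple obs => weight u v w).
Proof. exact: (measurable_prod_tnth (phi := fun=> phi) (fun=> mphi)). Qed.

(** Integrating the noise first, the Gaussian moment generating function at [u x / sigma ^+ 2]
    replaces the linear term by [u x ^+ 2 / 2]; only the uniform design remains. *)
Lemma gaussian_design_integral :
  (\int[(uniform_prob (@ltr01 R) \x normal_prob 0 sigma)%E]_z (phi z)%:E =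
   \int[lebesgue_measure]_(x in `[0%R, 1%R])
     (expR ((u x ^+ 2 / 2 + v x) / sigma ^+ 2))%:E)%E.
Proof.
rewrite fubini_tonelli1//=; last 2 first.
  exact/measurable_EFinP.
  by move=> z; rewrite lee_fin expR_ge0.
rewrite /fubini_F/=.
have E x : (\int[normal_prob 0 sigma]_y (phi (x, y))%:E =
    (expR ((u x ^+ 2 / 2 + v x) / sigma ^+ 2))%:E)%E.
  transitivity (\int[normal_prob 0 sigma]_y ((expR (v x / sigma ^+ 2))%:E *
     (expR (u x / sigma ^+ 2 * y))%:E))%E.
    apply: eq_integral => y _; rewrite /phi -EFinM -expRD/=; congr (expR _)%:E.
    by rewrite mulrDl addrC mulrAC.
  rewrite ge0_integralZl//=; last first.
    by apply/measurable_EFinP/measurableT_comp.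
  rewrite normal_mgf// -EFinM -expRD; congr (expR _)%:E.
  by field; rewrite gt_eqF.
under eq_integral do rewrite E.
rewrite integral_uniform//=; first by rewrite subr0 invr1 mul1e.
apply/measurable_EFinP/measurableT_comp => //; apply: measurable_funM => //.
by apply: measurable_funD => //; apply: measurable_funM => //; exact: measurable_funX.
Qed.

Lemma integral_weight_le (r : R) n :
  (\int[lebesgue_measure]_(x in `[0%R, 1%R])
     (expR ((u x ^+ 2 / 2 + v x) / sigma ^+ 2))%:E <= r%:E)%E ->
  (\int[design_noise sigma n]_w (weight u v w)%:E <= (r ^+ n)%:E)%E.
Proof.
move=> ur; apply: (integral_iid_expn_le n mphi (fun z => expR_ge0 _)).
by rewrite gaussian_design_integral.
Qed.

End design.

Section mixture.
Context d (U : measurableType d) (Pi : probability U R).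
Variables (u v : U -> R -> R) (S : set U) (n : nat).
Hypotheses (mu : measurable_fun setT (fun z : U * measurableTypeR R => u z.1 z.2)).
Hypotheses (mv : measurable_fun setT (fun z : U * measurableTypeR R => v z.1 z.2)).
Hypotheses (mS : measurable S).

Lemma measurable_weight2 :
  measurable_fun setT (fun z : n.-tuple obs * U => weight (u z.2) (v z.2) z.1).
Proof.
apply: measurable_prod => i _.
have m0 : measurable_fun setT (fun z : n.-tuple obs * U => tnth z.1 i).
  by apply: (measurableT_comp (@measurable_tnth _ obs n i)); exact: measurable_fst.
have m1 : measurable_fun setT (fun z : n.-tuple obs * U => (z.2, (tnth z.1 i).1) :
    U * measurableTypeR R).
  apply/measurable_fun_pairP; split; first exact: measurable_snd.
  exact: (measurableT_comp measurable_fst m0).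
have m2 : measurable_fun setT (fun z : n.-tuple obs * U => (tnth z.1 i).2).
  exact: (measurableT_comp measurable_snd m0).
apply: measurableT_comp => //; apply: measurable_funM => //.
apply: measurable_funD; last exact: (measurableT_comp mv m1).
by apply: measurable_funM => //; exact: (measurableT_comp mu m1).
Qed.

Lemma measurable_weight1 (w : n.-tuple (R * R)) :
  measurable_fun setT (fun b => weight (u b) (v b) w).
Proof.
apply: (measurableT_comp (f := fun z : n.-tuple obs * U => weight (u z.2) (v z.2) z.1)
  (g := fun b => (w, b))).
  exact: measurable_weight2.
exact: pair1_measurable.
Qed.

Let F (z : n.-tuple obs * U) : \bar R :=
  ((fun b => (weight (u b) (v b) z.1)%:E) \_ S) z.2.

Let F0 z : (0 <= F z)%E.
Proof. by rewrite /F patchE; case: ifP => // _; rewrite lee_fin ltW// weight_gt0. Qed.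

Let mF : measurable_fun setT F.
Proof.
have -> : F = (fun z => (weight (u z.2) (v z.2) z.1)%:E * (\1_S z.2)%:E)%E.
  apply/funext => z; rewrite /F patchE indicE.
  by case: ifP => _; rewrite ?mule1 ?mule0.
apply: emeasurable_funM; first by apply/measurable_EFinP; exact: measurable_weight2.
by apply/measurable_EFinP; apply: (measurableT_comp (measurable_indic mS)); exact: measurable_snd.
Qed.

Lemma measurable_mixture : measurable_fun setT
  (fun w : n.-tuple obs => \int[Pi]_(b in S) (weight (u b) (v b) w)%:E)%E.
Proof.
have := measurable_fun_fubini_tonelli_F (m2 := Pi) F mF F0.
by apply: eq_measurable_fun => w _; rewrite [RHS]integral_mkcond.
Qed.

(** By Tonelli the data are averaged before the parameter; for fixed [b], independence gives an
    [n]-th power. *)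
Lemma integral_mixture_le (r : R) : 0 <= r ->
  (forall b, S b -> \int[lebesgue_measure]_(x in `[0%R, 1%R])
     (expR ((u b x ^+ 2 / 2 + v b x) / sigma ^+ 2))%:E <= r%:E)%E ->
  (\int[design_noise sigma n]_w \int[Pi]_(b in S) (weight (u b) (v b) w)%:E <=
    (r ^+ n)%:E * Pi S)%E.
Proof.
move=> r0 br.
under eq_integral do rewrite integral_mkcond.
have := fubini_tonelli (m1 := design_noise sigma n) (m2 := Pi) F mF F0; rewrite /F/= => ->.
rewrite -integral_cst// [leRHS]integral_mkcond.
apply: ge0_le_integral_nonmeasurable => b _.
  by apply: integral_ge0 => w _; exact: (F0 (w, b)).
rewrite [leRHS]patchE; case: ifPn => bS.
  under eq_integral do rewrite patchE bS.
  apply: integral_weight_le.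
  - exact: (measurableT_comp mu (pair1_measurable b)).
  - exact: (measurableT_comp mv (pair1_measurable b)).
  - by apply: br; exact/set_mem.
under eq_integral do rewrite patchE (negbTE bS).
by rewrite integral0.
Qed.

End mixture.
End weights.

(** * Expectation of the posterior bound over the data *)

Section expected_posterior.
Context (R : realType) (sigma : R).
Hypothesis sigma_gt0 : 0 < sigma.
Notation obs := (measurableTypeR R * measurableTypeR R)%type.

Lemma normal_pdf_ratio (h e : R) :
  normal_pdf 0 sigma (e - h) =
  normal_pdf 0 sigma e * expR ((h * e + - (h ^+ 2 / 2)) / sigma ^+ 2).
Proof.
rewrite !normal_pdfE ?gt_eqF// /normal_fun -mulrA -expRD.
by congr (_ * expR _); field; rewrite gt_eqF.
Qed.

Lemma uniform_outside : (uniform_prob (@ltr01 R) \x normal_prob 0 sigma)%E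
  [set z | ~ (0 <= z.1 <= 1)] = 0%E.
Proof.
have m01 : measurable (~` `[0, 1] : set (measurableTypeR R)).
  by apply: measurableC; exact: measurable_itv.
rewrite (_ : [set z | _] = (~` `[0, 1]) `*` setT); last first.
  by apply/seteqP; split=> z /=; rewrite in_itv/=; [split|case].
rewrite product_measure1E//= /uniform_prob integral_uniform_pdf setIC setICr.
by rewrite integral_set0 mul0e.
Qed.

(** [Tb] and [f] are measurable substitutes for [rseries] on the almost sure event [E] and for [f0]
    on [0, 1]. [s] bounds the deviation from [f] on [B], [s'] the deviation from the centre [p j] on
    a cell, and [rho] the affinities of all centres. *)
Variables (Pi : probability (coefs R) R) (n : nat) (f0 f : R -> R).
Variables (Tb : coefs R -> R -> R) (E B Fc : set (coefs R)) (J : finType).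
Variables (C : J -> set (coefs R)) (p : J -> R -> R) (A : set (R -> R)).
Variables (s s' t rho : R).
Hypotheses (mTb : measurable_fun setT (fun z : coefs R * measurableTypeR R => Tb z.1 z.2)).
Hypotheses (mf : measurable_fun setT f) (f0f : forall x, 0 <= x <= 1 -> f0 x = f x).
Hypotheses (mE : measurable E) (E1 : Pi (~` E) = 0%E).
Hypotheses (ETb : forall b, E b -> rseries b = Tb b).
Hypotheses (mB : measurable B) (BE : B `<=` E) (PB : (0 < Pi B)%E).
Hypothesis Bs : forall b x, B b -> 0 <= x <= 1 -> `|Tb b x - f x| <= s.
Hypotheses (mFc : measurable Fc) (mC : forall j, measurable (C j)).
Hypothesis cover : forall b, E b -> A (rseries b) -> Fc b \/ exists j, C j b.
Hypothesis mp : forall j, measurable_fun setT (p j).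
Hypothesis Cs : forall j b x, C j b -> 0 <= x <= 1 -> `|Tb b x - f x - p j x| <= s'.
Hypothesis p_rho : forall j, (\int[@lebesgue_measure R]_(x in `[0%R, 1%R])
  (expR (- (p j x ^+ 2 / (16 * sigma ^+ 2))))%:E <= rho%:E)%E.
Hypothesis t_gt0 : 0 < t.

Let h b x := Tb b x - f x.
Let aw n (w : n.-tuple (R * R)) b := weight sigma (h b) (fun x => - (h b x ^+ 2 / 2)) w.

Let mh : measurable_fun setT (fun z : coefs R * measurableTypeR R => h z.1 z.2).
Proof. by apply: measurable_funB => //; apply: measurableT_comp. Qed.

Let mh2 : measurable_fun setT
  (fun z : coefs R * measurableTypeR R => h z.1 z.2 ^+ 2 / 2).
Proof. by apply: measurable_funM => //; exact: measurable_funX. Qed.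

Let mNh : measurable_fun setT
  (fun z : coefs R * measurableTypeR R => - h z.1 z.2).
Proof. exact: measurableT_comp. Qed.

Let mNh2 : measurable_fun setT
  (fun z : coefs R * measurableTypeR R => - (h z.1 z.2 ^+ 2 / 2)).
Proof. exact: measurableT_comp. Qed.

(** The right side of [posterior_bound], where [W j] is the square root of the likelihood ratio at
    the cell centre [p j], and the quotient of the ratio by [W j] is written as a single weight. *)
Let bound (w : n.-tuple (R * R)) : \bar R :=
  ((t / fine (Pi B) ^+ 2)%:E *
     \int[Pi]_(b in B) (weight sigma (fun x => - h b x) (fun x => h b x ^+ 2 / 2) w)%:E +
  (t^-1%:E * \int[Pi]_(b in Fc) (weight sigma (h b) (fun x => - (h b x ^+ 2 / 2)) w)%:E +
   \sum_(j : J) ((weight sigma (fun x => p j x / 2) (fun x => - (p j x ^+ 2 / 4)) w)%:E +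
     t^-1%:E * \int[Pi]_(b in C j) (weight sigma (fun x => h b x - p j x / 2)
        (fun x => - (h b x ^+ 2 / 2) + p j x ^+ 2 / 4) w)%:E)))%E.

Lemma posterior_le_bound (w : n.-tuple (R * R)) :
  (forall i, 0 <= (tnth w i).1 <= 1) ->
  ((posterior sigma Pi (data f0 w) A)%:E <= bound w)%E.
Proof.
move=> w01.
have maw : measurable_fun setT (aw w) by exact: (measurable_weight1 sigma mh mNh2).
have awV b : (aw w b)^-1 = weight sigma (fun x => - h b x) (fun x => h b x ^+ 2 / 2) w.
  rewrite /aw weightV; have -> // : (\- (fun x => - (h b x ^+ 2 / 2))) =
    (fun x => h b x ^+ 2 / 2) by apply/funext => x; rewrite /= opprK.
have mawV : measurable_fun setT (fun b => (aw w b)^-1).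
  apply: (eq_measurable_fun (fun b => weight sigma (fun x => - h b x)
      (fun x => h b x ^+ 2 / 2) w)); first by move=> b _; rewrite awV.
  exact: (measurable_weight1 sigma mNh mh2).
pose K := \prod_(i < n) normal_pdf 0 sigma (tnth w i).2.
pose lik b := likelihood sigma (data f0 w) (rseries b).
pose c := \prod_(i < n) normal_peak sigma.
have lik0 b : 0 <= lik b by apply: prodr_ge0 => i _; exact: normal_pdf_ge0.
have likc b : lik b <= c.
  apply: ler_prod => i _; rewrite /density normal_pdf_ge0 normal_pdf_ub//.
  by rewrite gt_eqF.
have K0 : 0 < K.
  apply: prodr_gt0 => i _; rewrite normal_pdfE ?gt_eqF// mulr_gt0 ?expR_gt0//.
  by rewrite normal_peak_gt0// gt_eqF.
have likE b : E b -> lik b = K * aw w b.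
  move=> Eb; rewrite /lik /K /aw /weight -big_split/=; apply: eq_bigr => i _.
  rewrite /density tnth_map/= ETb// f0f// -normal_pdf_ratio /h; congr (normal_pdf _ _ _).
  by ring.
have W0 j : 0 < weight sigma (fun x => p j x / 2) (fun x => - (p j x ^+ 2 / 4)) w.
  exact: weight_gt0.
have := @posterior_bound _ _ R Pi lik (aw w) c K E (@rseries R @^-1` A) B Fc J C
  (fun j => weight sigma (fun x => p j x / 2) (fun x => - (p j x ^+ 2 / 4)) w) t
  lik0 likc K0 maw (fun b => weight_gt0 _ _ _ _) mawV mE E1 likE mB BE PB mFc mC
  (fun b Ab Eb => cover Eb Ab) W0 t_gt0.
rewrite /posterior -/lik => /le_trans; apply.
rewrite /bound leeD//.
  rewrite lee_wpmul2l//; first by rewrite lee_fin divr_ge0 ?sqr_ge0// ltW.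
  rewrite le_eqVlt; apply/orP; left; apply/eqP; apply: eq_integral => b _.
  by rewrite awV.
rewrite leeD2l//; apply: lee_sum => j _; rewrite leeD2l//.
set W := weight _ _ _ _.
rewrite le_eqVlt; apply/orP; left; apply/eqP.
rewrite invfM EFinM -muleA; congr (_ * _)%E.
rewrite -ge0_integralZl//=; last 3 first.
  by apply/measurable_EFinP; exact: measurable_funTS.
  by move=> b _; rewrite lee_fin ltW// weight_gt0.
  by rewrite lee_fin invr_ge0 ltW ?W0.
apply: eq_integral => b _; rewrite -EFinM /W weightV weightM.
have -> : (\- (fun x => p j x / 2) \+ h b) = (fun x => h b x - p j x / 2).
  by apply/funext => x /=; rewrite addrC.
by have -> : (\- (fun x => - (p j x ^+ 2 / 4)) \+ (fun x => - (h b x ^+ 2 / 2))) =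
  (fun x => - (h b x ^+ 2 / 2) + p j x ^+ 2 / 4) by apply/funext => x /=; rewrite opprK addrC.
Qed.

Let mixB := measurable_mixture sigma Pi (n := n) (u := fun b x => - h b x)
  (v := fun b x => h b x ^+ 2 / 2) mNh mh2 mB.
Let mixF := measurable_mixture sigma Pi (n := n) (u := h)
  (v := fun b x => - (h b x ^+ 2 / 2)) mh mNh2 mFc.

Let mpj j : measurable_fun setT (fun z : coefs R * measurableTypeR R => p j z.2).
Proof. by apply: measurableT_comp => //; exact: mp. Qed.

Let mix1 j : measurable_fun setT
  (fun z : coefs R * measurableTypeR R => h z.1 z.2 - p j z.2 / 2).
Proof. by apply: measurable_funB => //; exact: measurable_funM. Qed.

Let mix2 j : measurable_fun setT
  (fun z : coefs R * measurableTypeR R => - (h z.1 z.2 ^+ 2 / 2) + p j z.2 ^+ 2 / 4).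
Proof.
by apply: measurable_funD => //; apply: measurable_funM => //; exact: measurable_funX.
Qed.

Let mixC j := measurable_mixture sigma Pi (n := n) (u := fun b x => h b x - p j x / 2)
  (v := fun b x => - (h b x ^+ 2 / 2) + p j x ^+ 2 / 4) (mix1 j) (mix2 j) (mC j).

Let mix0 S u v (w : n.-tuple (R * R)) :
  (0 <= \int[Pi]_(b in S) (weight sigma (u b) (v b) w)%:E)%E.
Proof. by apply: integral_ge0 => b _; rewrite lee_fin ltW// weight_gt0. Qed.

(** For the inverse ratio the noise contributes a second [h ^+ 2 / 2] to the exponent, and
    [|h| <= s] on [B]. *)
Let integral_B :
  (\int[design_noise sigma n]_w \int[Pi]_(b in B)
    (weight sigma (fun x => - h b x) (fun x => h b x ^+ 2 / 2) w)%:E <=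
   (expR (s ^+ 2 / sigma ^+ 2) ^+ n)%:E * Pi B)%E.
Proof.
have H := @integral_mixture_le R sigma sigma_gt0 _ _ Pi (fun b x => - h b x)
  (fun b x => h b x ^+ 2 / 2) B n mNh mh2 mB (expR (s ^+ 2 / sigma ^+ 2)) (expR_ge0 _).
apply: H => b Bb.
apply: (@le_trans _ _ (\int[@lebesgue_measure R]_(x in `[0%R, 1%R])
    (expR (s ^+ 2 / sigma ^+ 2))%:E)%E).
  apply: ge0_le_integral_nonmeasurable => x; first by move=> _; rewrite lee_fin expR_ge0.
  rewrite /= in_itv/= => x01; rewrite lee_fin ler_expR ler_wpM2r ?invr_ge0 ?sqr_ge0//.
  have -> : (- h b x) ^+ 2 / 2 + h b x ^+ 2 / 2 = `|h b x| ^+ 2.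
    by rewrite real_normK ?num_real//; field.
  by rewrite lerXn2r ?nnegrE// ?(le_trans _ (Bs Bb x01))// Bs.
rewrite integral_cst//= lebesgue_measure_itv/= lte_fin ltr01 oppr0 adde0 mule1.
exact: lexx.
Qed.

(** The likelihood ratio has mean 1 under the truth: after averaging the noise the exponent
    vanishes. *)
Let integral_F :
  (\int[design_noise sigma n]_w \int[Pi]_(b in Fc)
    (weight sigma (h b) (fun x => - (h b x ^+ 2 / 2)) w)%:E <= Pi Fc)%E.
Proof.
have H := @integral_mixture_le R sigma sigma_gt0 _ _ Pi h
  (fun b x => - (h b x ^+ 2 / 2)) Fc n mh mNh2 mFc 1 ler01.
rewrite expr1n mul1e in H; apply: H => b Fb.
rewrite (eq_integral (cst 1%E)); last first.
  by move=> x _; rewrite subrr mul0r expR0.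
rewrite integral_cst//= lebesgue_measure_itv/= lte_fin ltr01 oppr0 adde0 mule1.
exact: lexx.
Qed.

(** The square root of the ratio has mean exponent [- p ^+ 2 / (8 * sigma ^+ 2)]. The weaker
    constant 16 in [rho] keeps half of it in reserve for [integral_C]. *)
Let integral_W j :
  (\int[design_noise sigma n]_w
    (weight sigma (fun x => p j x / 2) (fun x => - (p j x ^+ 2 / 4)) w)%:E <=
   (rho ^+ n)%:E)%E.
Proof.
have m1 : measurable_fun setT (fun x => p j x / 2) by exact: measurable_funM.
have m2 : measurable_fun setT (fun x => - (p j x ^+ 2 / 4)).
  by apply: measurableT_comp => //; apply: measurable_funM => //; exact: measurable_funX.
apply: (integral_weight_le sigma_gt0 m1 m2).
apply: le_trans (p_rho j); apply: ge0_le_integral_nonmeasurable => x _.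
  by rewrite lee_fin expR_ge0.
rewrite lee_fin ler_expR -subr_ge0.
have -> : - (p j x ^+ 2 / (16 * sigma ^+ 2)) - ((p j x / 2) ^+ 2 / 2 + - (p j x ^+
    2 / 4)) / sigma ^+ 2
  = (p j x / sigma) ^+ 2 / 16 by field; rewrite gt_eqF.
by rewrite divr_ge0 ?sqr_ge0.
Qed.

Let rho_ge0 (j : J) : 0 <= rho.
Proof.
by rewrite -lee_fin (le_trans _ (p_rho j))// integral_ge0// => x _; rewrite lee_fin expR_ge0.
Qed.

Let integral_C j :
  (\int[design_noise sigma n]_w \int[Pi]_(b in C j)
    (weight sigma (fun x => h b x - p j x / 2)
        (fun x => - (h b x ^+ 2 / 2) + p j x ^+ 2 / 4) w)%:E <=
   ((expR (s' ^+ 2 / sigma ^+ 2) * rho) ^+ n)%:E)%E.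
Proof.
have r0 : 0 <= expR (s' ^+ 2 / sigma ^+ 2) * rho by rewrite mulr_ge0 ?expR_ge0 ?(rho_ge0 j).
apply: (@le_trans _ _ (((expR (s' ^+ 2 / sigma ^+ 2) * rho) ^+ n)%:E * Pi (C j))%E); last first.
  by rewrite -[leRHS]mule1 lee_wpmul2l ?lee_fin ?exprn_ge0// probability_le1.
have H := @integral_mixture_le R sigma sigma_gt0 _ _ Pi (fun b x => h b x - p j x / 2)
  (fun b x => - (h b x ^+ 2 / 2) + p j x ^+ 2 / 4) (C j) n (mix1 j) (mix2 j) (mC j) _ r0.
apply: H => b Cb.
apply: (@le_trans _ _ ((expR (s' ^+ 2 / sigma ^+ 2))%:E *
  \int[@lebesgue_measure R]_(x in `[0%R, 1%R])
    (expR (- (p j x ^+ 2 / (16 * sigma ^+ 2))))%:E)%E); last first.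
  by rewrite EFinM lee_wpmul2l// lee_fin expR_ge0.
rewrite -ge0_integralZl//=; last first.
  apply/measurable_EFinP/measurableT_comp => //; apply: measurableT_comp => //.
  by apply: measurable_funM => //; apply: measurable_funX; exact: (measurable_funTS (mp j)).
apply: ge0_le_integral_nonmeasurable => x; first by move=> _; rewrite lee_fin expR_ge0.
rewrite /= in_itv/= => x01; rewrite -EFinM lee_fin -expRD ler_expR.
set q := p j x; set e := h b x - q.
have he : e ^+ 2 <= s' ^+ 2.
  rewrite -(real_normK (num_real e)) lerXn2r ?nnegrE//; last exact: Cs.
  by rewrite (le_trans _ (Cs Cb x01)).
have -> : h b x = q + e by rewrite /e; ring.
(* The cross term of [q] with the cell error [e] is absorbed by the reserve and by [s' ^+ 2],
   completing the square [(q / 4 + e) ^+ 2]. *)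
rewrite -subr_ge0.
have -> : s' ^+ 2 / sigma ^+ 2 - q ^+ 2 / (16 * sigma ^+ 2) -
   ((q + e - q / 2) ^+ 2 / 2 + (- ((q + e) ^+ 2 / 2) + q ^+ 2 / 4)) / sigma ^+ 2 =
   (s' ^+ 2 - e ^+ 2 + (q / 4 + e) ^+ 2) / sigma ^+ 2 by field; rewrite gt_eqF.
by rewrite divr_ge0 ?sqr_ge0// addr_ge0 ?sqr_ge0// subr_ge0.
Qed.

Lemma expected_posterior_le :
  ('E_(design_noise sigma n)[fun w => posterior sigma Pi (data f0 w) A] <=
   (t / fine (Pi B) * expR (n%:R * (s ^+ 2 / sigma ^+ 2)) + t^-1 * fine (Pi Fc) +
    #|J|%:R * ((1 + t^-1 * expR (n%:R * (s' ^+ 2 / sigma ^+ 2))) * rho ^+ n))%:E)%E.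
Proof.
have out_meas : measurable [set z : obs | ~ (0 <= z.1 <= 1)].
  rewrite (_ : [set z | _] = (~` `[0, 1]) `*` setT).
    by apply: measurableX => //; apply: measurableC; exact: measurable_itv.
  by apply/seteqP; split=> z /=; rewrite in_itv/=; [split|case].
pose out : set obs := [set z | ~ (0 <= z.1 <= 1)].
(* [Z] counts the design points outside [0, 1], where [f] need not equal [f0]. It has mean 0, and
   once it is positive it dominates the posterior, which is at most 1. *)
pose Z (w : n.-tuple obs) : \bar R := (\sum_(i < n) (\1_[set w | out (tnth w i)] w)%:E)%E.
have mout i : measurable [set w : n.-tuple obs | out (tnth w i)].
  rewrite -[X in measurable X]setTI; exact: (measurable_tnth _ measurableT).
have Z0 w : (0 <= Z w)%E by apply: sume_ge0 => i _; rewrite lee_fin.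
have mZ : measurable_fun setT Z.
  by apply: emeasurable_sum => i; apply/measurable_EFinP; exact: measurable_indic.
have IZ : (\int[design_noise sigma n]_w Z w = 0)%E.
  rewrite /Z ge0_integral_sum//; last first.
    by move=> i; apply/measurable_EFinP; exact: measurable_indic.
  rewrite big1// => i _; rewrite integral_indic// setIT.
  rewrite [LHS](iid_tnth (uniform_prob (@ltr01 R) \x normal_prob 0 sigma)%E)//.
  exact: uniform_outside.
have PBf : Pi B \is a fin_num by exact: fin_num_measure.
have PFf : Pi Fc \is a fin_num by exact: fin_num_measure.
have PB0 : 0 < fine (Pi B) by rewrite -lte_fin fineK.
have tB0 : (0 <= (t / fine (Pi B) ^+ 2)%:E)%E.
  by rewrite lee_fin divr_ge0 ?sqr_ge0// ltW.
have tV0 : (0 <= (t^-1)%:E)%E by rewrite lee_fin invr_ge0 ltW.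
have mW j : measurable_fun setT (fun w : n.-tuple obs =>
    (weight sigma (fun x => p j x / 2) (fun x => - (p j x ^+ 2 / 4)) w)%:E).
  apply/measurable_EFinP; apply: measurable_weight; first exact: measurable_funM.
  by apply: measurableT_comp => //; apply: measurable_funM => //; exact: measurable_funX.
rewrite unlock; apply: (@le_trans _ _ (\int[design_noise sigma n]_w (Z w + bound w))%E).
  apply: ge0_le_integral_nonmeasurable => w _.
    rewrite lee_fin divr_ge0// fine_ge0// integral_ge0// => b _.
      by rewrite lee_fin prodr_ge0// => i _; exact: normal_pdf_ge0.
    by rewrite lee_fin prodr_ge0// => i _; exact: normal_pdf_ge0.
  have b0 : (0 <= bound w)%E.
    rewrite /bound !adde_ge0 ?mule_ge0 ?mix0// sume_ge0// => j _.
    by rewrite adde_ge0 ?mule_ge0 ?mix0// lee_fin ltW// weight_gt0.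
  have [w01|/existsNP[i wi]] := pselect (forall i, 0 <= (tnth w i).1 <= 1).
    by rewrite (le_trans (posterior_le_bound w01))// leeDr.
  apply: (@le_trans _ _ 1%E).
    rewrite lee_fin; apply: (@posterior_le1 _ _ _ _ _ (normal_peak sigma ^+ n)) => b.
      by apply: prodr_ge0 => k _; exact: normal_pdf_ge0.
    rewrite -[n in leRHS]card_ord -prodr_const.
    apply: ler_prod => k _; rewrite /density normal_pdf_ge0 normal_pdf_ub//.
    by rewrite gt_eqF.
  rewrite -[leLHS]adde0 leeD// /Z (bigD1 i)//= -[leLHS]adde0 leeD//.
    by rewrite indicE mem_set.
  by rewrite sume_ge0// => k _; rewrite lee_fin.
have m2 : measurable_fun setT (fun w : n.-tuple obs =>
    (\sum_(j : J) ((weight sigma (fun x => p j x / 2) (fun x => - (p j x ^+ 2 / 4)) w)%:E +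
     t^-1%:E * \int[Pi]_(b in C j) (weight sigma (fun x => h b x - p j x / 2)
        (fun x => - (h b x ^+ 2 / 2) + p j x ^+ 2 / 4) w)%:E))%E).
  apply: emeasurable_sum => j; apply: emeasurable_funD => //.
  by apply: measurable_funeM; exact: mixC.
have p2 j (w : n.-tuple (R * R)) : (0 <= (weight sigma (fun x => p j x / 2)
        (fun x => - (p j x ^+ 2 / 4)) w)%:E +
     t^-1%:E * \int[Pi]_(b in C j) (weight sigma (fun x => h b x - p j x / 2)
        (fun x => - (h b x ^+ 2 / 2) + p j x ^+ 2 / 4) w)%:E)%E.
  apply: adde_ge0; first by rewrite lee_fin ltW// weight_gt0.
  apply: mule_ge0 => //; apply: integral_ge0 => b _.
have mB' := measurable_funeM (t / fine (Pi B) ^+ 2)%:E mixB.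
have mF' := measurable_funeM (t^-1)%:E mixF.
rewrite ge0_integralD//=; last 2 first.
  move=> w _; rewrite /bound !adde_ge0 ?mule_ge0 ?mix0// sume_ge0//.
  by apply: emeasurable_funD => //; apply: emeasurable_funD.
rewrite IZ add0e /bound ge0_integralD//=; last 2 first.
  by move=> w _; rewrite adde_ge0 ?mule_ge0 ?mix0// sume_ge0.
  exact: emeasurable_funD.
rewrite ge0_integralD//=; last 2 first.
  by move=> w _; rewrite mule_ge0 ?mix0.
  by move=> w _; rewrite sume_ge0.
rewrite -[X in (_ <= X%:E)%E]addrA EFinD; apply: leeD.
  rewrite ge0_integralZl//=.
  apply: (@le_trans _ _ ((t / fine (Pi B) ^+ 2)%:E *
      ((expR (s ^+ 2 / sigma ^+ 2) ^+ n)%:E * Pi B))%E).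
    by rewrite lee_wpmul2l// integral_B.
  rewrite -(fineK PBf) -!EFinM lee_fin expRM_natl le_eqVlt; apply/orP; left; apply/eqP.
  by field; rewrite gt_eqF.
rewrite EFinD; apply: leeD.
  rewrite ge0_integralZl//=.
  by rewrite EFinM fineK// lee_wpmul2l// integral_F.
rewrite ge0_integral_sum//; last first.
  move=> j; apply: emeasurable_funD => //.
  by apply: measurable_funeM; exact: mixC.
apply: (@le_trans _ _ (\sum_(j : J)
   ((1 + t^-1 * expR (n%:R * (s' ^+ 2 / sigma ^+ 2))) * rho ^+ n)%:E)%E); last first.
  by rewrite sumEFin sumr_const lee_fin -[leLHS]mulr_natl.
apply: lee_sum => j _; rewrite ge0_integralD//=; last 2 first.
  by move=> w _; rewrite mule_ge0 ?mix0.
  by apply: measurable_funeM; exact: mixC.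
rewrite mulrDl mul1r EFinD; apply: leeD.
  exact: (integral_W j).
rewrite ge0_integralZl//=.
rewrite expRM_natl -mulrA -exprMn EFinM lee_wpmul2l//.
by move=> w _; rewrite lee_fin ltW// weight_gt0.
by move=> w _; rewrite mule_ge0 ?mix0.
Qed.

End expected_posterior.

(** * The random series prior *)

Section probability_of_measure.
Context d (T : measurableType d) (R : realType) (mu : {measure set T -> \bar R}).
Hypothesis mu1 : mu setT = 1%E.

(** [random_series_prior] is typed as a mere measure; taking the proof of total mass 1 as an
    argument lets a probability structure be attached to the same set function. *)
Definition probability_of (_ : mu setT = 1%E) : set T -> \bar R := mu.

HB.instance Definition _ := Measure.on (probability_of mu1).
HB.instance Definition _ :=
  @Measure_isProbability.Build _ _ R (probability_of mu1) mu1.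

Definition prob_of : probability T R := probability_of mu1.

End probability_of_measure.

Section coefficient_space.
Context (R : realType).

Lemma measurable_coef (k : nat) : measurable_fun setT (fun b : coefs R => b k : measurableTypeR R).
Proof.
move=> _ A mA; apply: sub_sigma_algebra; exists k => //.
by exists A.
Qed.

Lemma measurable_coef_eq0 (k : nat) : measurable [set b : coefs R | b k = 0].
Proof.
rewrite -[X in measurable X]setTI.
exact: (@measurable_coef k measurableT [set 0] (measurable_set1 _)).
Qed.

Definition dim_le (m : nat) : set (coefs R) :=
  [set b | forall k, (m < k)%N -> b k = 0].

Definition finite_dim : set (coefs R) := \bigcup_m dim_le m.

Lemma measurable_dim_le m : measurable (dim_le m).
Proof.
rewrite (_ : dim_le m = \bigcap_(k in [set k | (m < k)%N]) [set b | b k = 0]).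
  apply: bigcap_measurable => [|k _]; last exact: measurable_coef_eq0.
  by exists m.+1 => /=.
by apply/seteqP; split.
Qed.

Lemma measurable_finite_dim : measurable finite_dim.
Proof. by apply: bigcup_measurable => m _; exact: measurable_dim_le. Qed.

Lemma measurable_psi k : measurable_fun setT (@psi R k).
Proof.
apply: (eq_measurable_fun (fun x => cos (freq R k * x + phase R k))).
  by move=> x _; rewrite psiE.
apply: continuous_measurable_fun => x; apply: continuous_comp; last exact: continuous_cos.
by apply: cvgD; [apply: cvgM; [exact: cvg_cst|exact: cvg_id]|exact: cvg_cst].
Qed.

Lemma psi_le1 k x : `|@psi R k x| <= 1.
Proof. by rewrite psiE cos_max. Qed.

Lemma rseries_dim_le m (b : coefs R) x : dim_le m b ->
  (\sum_(1 <= k < n) b k * psi k x @[n --> \oo] -->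
    \sum_(1 <= k < m.+1) b k * psi k x)%R.
Proof.
move=> bm; apply: cvg_near_cst; exists m.+1 => // n /= mn.
rewrite (@big_cat_nat _ _ _ m.+1)//= [X in _ + X]big_nat_cond [X in _ + X]big1 ?addr0//.
by move=> k /andP[/andP[mk _] _]; rewrite bm// mul0r.
Qed.

Lemma rseriesE m (b : coefs R) x : dim_le m b ->
  rseries b x = \sum_(1 <= k < m.+1) b k * psi k x.
Proof. by move=> bm; apply/cvg_lim => //; exact: rseries_dim_le. Qed.

(** The cut-off by [finite_dim] makes the partial sums converge at every sequence, so that joint
    measurability follows from a pointwise limit; almost surely it changes nothing. *)
Definition series_fun (b : coefs R) (x : R) : R := \1_finite_dim b * rseries b x.

Lemma series_funE m (b : coefs R) x : dim_le m b ->
  series_fun b x = \sum_(1 <= k < m.+1) b k * psi k x.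
Proof.
move=> bm; rewrite /series_fun (rseriesE _ bm) indicE mem_set ?mul1r//.
by exists m.
Qed.

Lemma measurable_series_fun :
  measurable_fun setT (fun z : coefs R * measurableTypeR R => series_fun z.1 z.2).
Proof.
apply: (@measurable_fun_cvg _ _ R setT (fun n (z : coefs R * measurableTypeR R) =>
  \1_finite_dim z.1 * \sum_(1 <= k < n) z.1 k * psi k z.2)).
  move=> n; apply: measurable_funM.
    apply: (measurableT_comp (measurable_indic measurable_finite_dim)).
    exact: measurable_fst.
  apply: measurable_sum => k; apply: measurable_funM.
    exact: (measurableT_comp (measurable_coef k) measurable_fst).
  exact: (measurableT_comp (measurable_psi k) measurable_snd).
move=> [b x] _; rewrite /series_fun/=.
have [[m _ bm]|nb] := pselect (finite_dim b).
  apply: cvgM; first exact: cvg_cst.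
  by rewrite (rseriesE _ bm); exact: rseries_dim_le.
rewrite indicE memNset// mul0r; under eq_fun do rewrite mul0r.
exact: cvg_cst.
Qed.

End coefficient_space.

Section coefficient_law.
Context (R : realType) (tau tau0 c : R) (g : R -> R).
Hypotheses (tau_gt0 : 0 < tau) (tau0_gt0 : 0 < tau0).
Hypothesis gE : forall x, g x = c * expR (- (tau0 * `|x| `^ tau)).
Variable G : probability (measurableTypeR R) R.
Hypothesis G_density : forall A : set (measurableTypeR R), measurable A ->
  G A = (\int[lebesgue_measure]_(x in A) (g x)%:E)%E.

Lemma measurable_tail_density (k : R) :
  measurable_fun setT (fun x : R => expR (- (k * `|x| `^ tau))).
Proof.
apply: measurableT_comp => //; apply: measurableT_comp => //.
apply: measurable_funM => //.
by apply: (measurableT_comp (@measurable_powR R tau)); exact: normr_measurable.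
Qed.

Lemma measurable_density : measurable_fun setT g.
Proof.
rewrite (funext gE); apply: measurable_funM => //. exact: (measurable_tail_density tau0).
Qed.

(** For [c <= 0] the positive part of [g] vanishes and the total mass could not be 1. *)
Lemma density_constant_gt0 : 0 < c.
Proof.
rewrite ltNge; apply/negP => c0.
have := probability_setT G; rewrite G_density// integralE.
rewrite (eq_integral (cst 0%E)); last first.
  move=> x _; rewrite funeposE; apply/max_idPr.
  by rewrite lee_fin gE mulr_le0_ge0// expR_ge0.
rewrite integral0 sub0e => e1.
have : (0 <= - (1 : \bar R))%E.
  by rewrite -e1 oppeK; apply: integral_ge0 => x _; exact: funeneg_ge0.
by rewrite oppe_ge0 lee_fin ler10.
Qed.

(** The interval lies in [-(Q + 1), Q + 1], where [g] is at least its value at the endpoints. *)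
Lemma interval_mass_ge (b Q eta : R) : `|b| <= Q -> 0 < eta <= 1 ->
  ((2 * eta * (c * expR (- (tau0 * (Q + 1) `^ tau))))%:E <=
    G [set x | (`|x - b| <= eta)%R])%E.
Proof.
move=> bQ /andP[eta0 eta1].
have Q0 : 0 <= Q by apply: le_trans bQ.
have -> : [set x | `|x - b| <= eta] = `[b - eta, b + eta]%classic.
  by apply/seteqP; split => x /=; rewrite in_itv/= ler_distl.
rewrite G_density//.
apply: (@le_trans _ _ (\int[@lebesgue_measure R]_(x in `[(b - eta)%R, (b + eta)%R])
   (cst (c * expR (- (tau0 * (Q + 1) `^ tau)))%:E) x)%E).
  rewrite integral_cst//= lebesgue_measure_itv/= lte_fin ltrD2l.
  rewrite gtrN// -EFinB -EFinM lee_fin le_eqVlt; apply/orP; left; apply/eqP; ring.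
apply: ge0_le_integral => //=.
- by move=> x _; rewrite lee_fin mulr_ge0 ?expR_ge0// ltW// density_constant_gt0.
- by apply/measurable_EFinP; apply: measurable_funTS; exact: measurable_density.
move=> x; rewrite in_itv/= -ler_distl => xb; rewrite lee_fin gE.
rewrite ler_wpM2l ?(ltW density_constant_gt0)// ler_expR lerN2 ler_wpM2l ?(ltW tau0_gt0)//.
rewrite ge0_ler_powR ?nnegrE ?(ltW tau_gt0)//; first by rewrite addr_ge0.
have -> : x = (x - b) + b by rewrite subrK.
rewrite (le_trans (ler_normD _ _))// addrC lerD// (le_trans xb)//.
Qed.

(** With [q] above [2 / tau], [x ^+ 2] is at most the [q]-th power of [|x| ^ tau] for [|x| > 1], and
    an exponential dominates that power. The target [1 / (1 + x ^+ 2)] has the explicit integral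
    [pi]. *)
Lemma expRN_powR_le : exists2 K : R, 0 < K &
  forall x, expR (- (tau0 / 2 * `|x| `^ tau)) <= K * (1 + x ^+ 2)^-1.
Proof.
pose q := (Num.truncn (2 / tau)).+1.
have q0 : 0 < q%:R :> R by rewrite ltr0n.
pose a := tau0 / (2 * q%:R).
have a0 : 0 < a by rewrite /a divr_gt0// mulr_gt0.
exists (2 * (1 + a^-1 ^+ q)).
  by rewrite mulr_gt0// addr_gt0// exprn_gt0// invr_gt0.
move=> x; rewrite expRN ler_pdivlMr; last by rewrite ltr_pwDl// sqr_ge0.
rewrite mulrC ler_pdivrMr ?expR_gt0//.
have e1 : 1 <= expR (tau0 / 2 * `|x| `^ tau).
  by rewrite -expR0 ler_expR mulr_ge0 ?powR_ge0// divr_ge0// ltW.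
have aq : 0 < a^-1 ^+ q by rewrite exprn_gt0// invr_gt0.
have [x1|x1] := leP `|x| 1.
  have : x ^+ 2 <= 1 by rewrite -(real_normK (num_real x)) expr_le1.
  by nra.
have xq : x ^+ 2 <= (`|x| `^ tau) ^+ q.
  rewrite -(real_normK (num_real x)) -!powR_mulrn ?powR_ge0// -powRrM ler_powR ?(ltW x1)//.
  by rewrite mulrC -ler_pdivrMr// ltW// Num.Theory.truncnS_gt.
have xe : (`|x| `^ tau) ^+ q <= a^-1 ^+ q * expR (tau0 / 2 * `|x| `^ tau).
  rewrite exprVn ler_pdivlMl ?exprn_gt0// -exprMn.
  have -> : tau0 / 2 * `|x| `^ tau = q%:R * (a * `|x| `^ tau).
    by rewrite /a; field; rewrite gt_eqF.
  rewrite expRM_natl; apply: lerXn2r.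
  - by rewrite nnegrE mulr_ge0 ?powR_ge0// ltW.
  - by rewrite nnegrE expR_ge0.
  by rewrite (le_trans _ (expR_ge1Dx _))// lerDr.
have : 1 <= x ^+ 2 by rewrite -(real_normK (num_real x)) exprn_ege1// ltW.
by nra.
Qed.

(** Half of the exponent pays for integrability through [expRN_powR_le], the other half is evaluated
    at [B]. *)
Lemma tail_mass_le : exists2 K : R, 0 < K & forall B, 0 <= B ->
  (G [set x | (B < `|x|)%R] <= (K * expR (- (tau0 / 2 * B `^ tau)))%:E)%E.
Proof.
have [K K0 HK] := expRN_powR_le.
exists (c * K * pi); first by rewrite !mulr_gt0 ?density_constant_gt0 ?pi_gt0.
move=> B B0.
have mB : measurable [set x : R | B < `|x|].
  rewrite (_ : [set x | _] = ~` `[- B, B]); first by apply: measurableC; exact: measurable_itv.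
  apply/seteqP; split => x /=; rewrite in_itv/= -ler_norml => h.
    by apply/negP; rewrite -ltNge.
  by rewrite ltNge; apply/negP.
rewrite G_density// integral_mkcond.
set k := c * K * expR (- (tau0 / 2 * B `^ tau)).
have k0 : 0 <= k by rewrite /k !mulr_ge0 ?expR_ge0// ltW// density_constant_gt0.
apply: (@le_trans _ _ (\int[@lebesgue_measure R]_x (k%:E * ((oneDsqr x)^-1)%:E))%E).
  apply: ge0_le_integral_nonmeasurable => x _; rewrite patchE.
    by case: ifP => // _; rewrite lee_fin gE mulr_ge0 ?expR_ge0// ltW// density_constant_gt0.
  case: ifPn => [/set_mem/= Bx|_]; last first.
    by rewrite mule_ge0 ?lee_fin// invr_ge0 (le_trans ler01)// oneDsqr_ge1.
  rewrite -EFinM lee_fin gE /k /oneDsqr.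
  have -> : c * K * expR (- (tau0 / 2 * B `^ tau)) * (1 + x ^+ 2)^-1 =
    c * (K * (1 + x ^+ 2)^-1 * expR (- (tau0 / 2 * B `^ tau))) by ring.
  rewrite ler_wpM2l ?(ltW density_constant_gt0)//.
  have -> : tau0 * `|x| `^ tau = tau0 / 2 * `|x| `^ tau + tau0 / 2 * `|x| `^ tau by field.
  rewrite opprD expRD ler_pM ?expR_ge0//.
  rewrite ler_expR lerN2 ler_wpM2l ?divr_ge0 ?(ltW tau0_gt0)//.
  by rewrite ge0_ler_powR ?nnegrE ?(ltW tau_gt0)// ltW.
rewrite ge0_integralZl//=; last first.
  apply/measurable_EFinP; apply: (@continuous_measurable_fun R (fun x => (oneDsqr x)^-1)) => x.
  exact: continuous_oneDsqrV.
rewrite ge0_symfun_integralT//=; last 2 first.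
  exact: continuous_oneDsqrV.
  by move=> x; rewrite /oneDsqr/= sqrrN.
rewrite (_ : [set x | _] = `[0, +oo[%classic); last first.
  by apply/seteqP; split => x/=; rewrite in_itv/= andbT.
rewrite integral0y_oneDsqr -!EFinM lee_fin /k le_eqVlt; apply/orP; left; apply/eqP.
by field.
Qed.

End coefficient_law.

Section prior_mass.
Context (R : realType) (piN : nat -> {nonneg R}) (G : probability (measurableTypeR R) R).
Hypothesis piN_sum1 : (\sum_(1 <= m <oo) ((piN m)%:num)%:E = 1)%E.
Local Notation Pi := (random_series_prior piN G).

Lemma priorE (A : set (coefs R)) :
  Pi A = (\sum_(1 <= m <oo) ((piN m)%:num)%:E *
           iid G m (@coefs_of_tuple R m @^-1` A))%E.
Proof. by []. Qed.

Lemma measurable_preimage_coefs m (A : set (coefs R)) : measurable A ->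
  measurable (@coefs_of_tuple R m @^-1` A).
Proof.
by move=> mA; rewrite -[X in measurable X]setTI; exact: measurable_coefs_of_tuple.
Qed.

Lemma prior_setT : Pi setT = 1%E.
Proof.
rewrite priorE -[RHS]piN_sum1; apply: eq_eseriesr => m _.
by rewrite preimage_setT probability_setT mule1.
Qed.

Lemma dim_le_coefs_of_tuple m k (b : m.-tuple (measurableTypeR R)) : (m <= k)%N ->
  dim_le k (coefs_of_tuple b).
Proof.
by move=> mk [|j]//= kj; rewrite nth_default// size_tuple (leq_trans mk).
Qed.

Lemma prior_infinite_dim : Pi (~` finite_dim (R := R)) = 0%E.
Proof.
rewrite priorE eseries0// => m _ _.
rewrite (_ : _ @^-1` _ = set0) ?measure0 ?mule0//.
apply/seteqP; split => // b /=; apply; exists m => //.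
exact: dim_le_coefs_of_tuple.
Qed.

Let term0 (A : set (coefs R)) m :
  (0 <= ((piN m)%:num)%:E * iid G m (@coefs_of_tuple R m @^-1` A))%E.
Proof. by rewrite mule_ge0// lee_fin. Qed.

Lemma prior_dim_gt m :
  (Pi (~` dim_le (R := R) m) <= \sum_(m.+1 <= N <oo) ((piN N)%:num)%:E)%E.
Proof.
rewrite priorE (@nneseries_split _ _ 1 m)//.
rewrite big_nat_cond big1 ?add0e; last first.
  move=> k /andP[/andP[_ km] _]; rewrite add1n ltnS in km.
  rewrite (_ : _ @^-1` _ = set0) ?measure0 ?mule0//.
  by apply/seteqP; split => // b /=; apply; exact: dim_le_coefs_of_tuple.
rewrite add1n; apply: lee_nneseries => // N _.
rewrite -[leRHS]mule1 lee_wpmul2l ?lee_fin// probability_le1//.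
by apply: measurable_preimage_coefs; apply: measurableC; exact: measurable_dim_le.
Qed.

Lemma prior_tail_coef k (B : R) : 0 <= B ->
  (Pi [set b | (B < `|b k|)%R] <= G [set x | (B < `|x|)%R])%E.
Proof.
move=> B0.
have mB : measurable [set x : measurableTypeR R | B < `|x|].
  rewrite (_ : [set x | _] = ~` `[- B, B]).
    by apply: measurableC; exact: measurable_itv.
  apply/seteqP; split => x /=; rewrite in_itv/= -ler_norml => h.
    by apply/negP; rewrite -ltNge.
  by rewrite ltNge; apply/negP.
have mS : measurable [set b : coefs R | B < `|b k|].
  rewrite -[X in measurable X]setTI.
  exact: (@measurable_coef R k measurableT _ mB).
have Gf : G [set x | (B < `|x|)%R] \is a fin_num by exact: fin_num_measure.
apply: (@le_trans _ _ (\sum_(1 <= m <oo) (fine (G [set x | (B < `|x|)%R]))%:E *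
    ((piN m)%:num)%:E)%E).
  rewrite priorE; apply: lee_nneseries => // m _; rewrite fineK// muleC lee_wpmul2r ?lee_fin//.
  (* Tuples are indexed from 0, so coefficient [k] is entry [k.-1]. Index 0 and the indices beyond
     [m] carry the value 0, which does not exceed [B]. *)
  have [km|mk] := ltnP k.-1 m; last first.
    rewrite (_ : _ @^-1` _ = set0) ?measure0//; apply/seteqP; split => // b /=.
    case: k mk {mS} => [|j] mk /=; first by rewrite normr0 ltNge B0.
    by rewrite nth_default ?normr0 ?size_tuple// ltNge B0.
  case: k km {mS} => [|j] km.
    by rewrite (_ : _ @^-1` _ = set0) ?measure0//; apply/seteqP; split => // b /=;
        rewrite normr0 ltNge B0.
  rewrite -(iid_tnth G (Ordinal km) mB) le_eqVlt; apply/orP; left; apply/eqP.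
  by congr (iid G m _); apply/seteqP; split => b /=; rewrite (tnth_nth 0).
by rewrite nneseriesZl// piN_sum1 mule1 fineK.
Qed.

Definition box (m : nat) (b0 : nat -> R) (eta : R) : set (coefs R) :=
  [set b | dim_le m b /\ forall k, (1 <= k <= m)%N -> `|b k - b0 k| <= eta].

Lemma measurable_interval (b eta : R) :
  measurable [set x : measurableTypeR R | `|x - b| <= eta].
Proof.
rewrite (_ : [set x | _] = `[b - eta, b + eta]%classic); first exact: measurable_itv.
by apply/seteqP; split => x /=; rewrite in_itv/= ler_distl.
Qed.

Lemma measurable_box m b0 eta : measurable (box m b0 eta).
Proof.
rewrite (_ : box m b0 eta = dim_le m `&` \bigcap_(k in [set k | (1 <= k <= m)%N])
    [set b : coefs R | `|b k - b0 k| <= eta]); last first.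
  by apply/seteqP; split => b [bm bk]; split.
apply: measurableI; first exact: measurable_dim_le.
have [->|m0] := posnP m.
  rewrite (_ : [set k | _] = set0) ?bigcap_set0//.
  by apply/seteqP; split => // k /=; lia.
apply: bigcap_measurable => [|k _]; first by exists 1%N => /=; lia.
rewrite -[X in measurable X]setTI.
exact: (@measurable_coef R k measurableT _ (measurable_interval _ _)).
Qed.

(** Only the component of the mixture with exactly [m] terms is kept; there the box probability is a
    product over the coefficients. *)
Lemma prior_box_ge m (b0 : nat -> R) (eta delta : R) : (0 < m)%N -> 0 <= delta ->
  (forall k, (1 <= k <= m)%N -> delta%:E <= G [set x | (`|x - b0 k| <= eta)%R])%E ->
  (((piN m)%:num * delta ^+ m)%:E <= Pi (box m b0 eta))%E.
Proof.
move=> m0 d0 dG.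
apply: (@le_trans _ _ (((piN m)%:num)%:E * iid G m (@coefs_of_tuple R m @^-1` (box m b0 eta)))%E).
  rewrite EFinM lee_wpmul2l ?lee_fin//.
  pose phi (i : nat) : measurableTypeR R -> R := \1_[set x | `|x - b0 i.+1| <= eta].
  pose r (i : nat) := fine (G [set x | (`|x - b0 i.+1| <= eta)%R]).
  have mphi i : measurable_fun setT (phi i).
    exact: (measurable_indic (measurable_interval _ _)).
  have phi0 i x : 0 <= phi i x by rewrite /phi indicE.
  have phir i : (\int[G]_x (phi i x)%:E = (r i)%:E)%E.
    rewrite /phi integral_indic//; last exact: measurable_interval.
    by rewrite setIT fineK// fin_num_measure//; exact: measurable_interval.
  apply: (@le_trans _ _ (\prod_(i < m) r i)%:E).
    rewrite lee_fin -[m in delta ^+ m]card_ord -prodr_const; apply: ler_prod => i _.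
    rewrite d0 -lee_fin fineK; first by apply: dG; rewrite /= ltn_ord.
    by apply: fin_num_measure; exact: measurable_interval.
  rewrite -(integral_iid_prod m mphi phi0 phir).
  rewrite -[leRHS](_ : (\int[iid G m]_x (\1_(@coefs_of_tuple R m @^-1` box m b0
      eta) x)%:E = _)%E); last first.
    rewrite integral_indic ?setIT//.
    by apply: measurable_preimage_coefs; exact: measurable_box.
  apply: ge0_le_integral_nonmeasurable => b _; first by rewrite lee_fin prodr_ge0.
  rewrite lee_fin indicE.
  have [inb|/negP nb] := boolP (b \in _).
    apply: (@le_trans _ _ (\prod_(i < m) 1)); last by rewrite big1.
    by apply: ler_prod => i _; rewrite phi0 /phi indicE lern1 leq_b1.
  have [i bi] : exists i : 'I_m, ~ (`|tnth b i - b0 i.+1| <= eta).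
    apply/existsNP => H; apply: nb; rewrite inE; split.
      exact: dim_le_coefs_of_tuple.
    move=> [//|k] /= km; have := H (Ordinal km).
    by rewrite (tnth_nth 0).
  by rewrite (bigD1 i)//= /phi indicE memNset// mul0r.
rewrite priorE (@nneseries_split _ _ 1 m)// add1n.
rewrite big_nat_recr//= -[leLHS]add0e -[leLHS]adde0; apply: leeD.
  by apply: leeD => //; apply: sume_ge0.
by apply: nneseries_ge0.
Qed.

End prior_mass.

(** * Approximation in the Hoelder ball *)

Section regression_function.
Context (R : realType).

Lemma L2norm_gt (h : R -> R) (r : R) : 0 <= r -> (r%:E < L2norm h)%E ->
  ((r ^+ 2)%:E <= \int[@lebesgue_measure R]_(x in `[0%R, 1%R]) (h x ^+ 2)%:E)%E.
Proof.
move=> r0 rh.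
have -> : (\int[@lebesgue_measure R]_(x in `[0%R, 1%R]) (h x ^+ 2)%:E = L2norm h `^ 2)%E.
  rewrite /L2norm poweR_Lnorm// [LHS]integral_mkcond; apply: eq_integral => x _.
  rewrite !patchE; case: ifP => _ /=.
    by rewrite powR_mulrn// real_normK// num_real.
  by rewrite normr0 powR0.
have -> : (r ^+ 2)%:E = (r%:E `^ 2)%E by rewrite poweR_EFin powR_mulrn.
by rewrite gt0_ler_poweR// ?in_itv/= ?leey ?andbT ?lee_fin ?(ltW rh)// (le_trans _ (ltW rh)).
Qed.

Variables (alpha Q : R) (f0 : R -> R) (b : nat -> R).
Hypotheses (alpha_gt0 : 0 < alpha) (Q_gt0 : 0 < Q).
Hypothesis f0_lim : forall x : R, x \in `[0, 1] ->
      \sum_(1 <= k < n) b k * psi k x @[n --> \oo] --> f0 x.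
Hypothesis b_sum : (\sum_(1 <= k <oo) (k%:R `^ alpha * `|b k|)%:E <= Q%:E)%E.

(** Membership in the ball constrains [f0] on [0, 1] only; cut off there, it is a pointwise limit of
    measurable functions. *)
Definition truncated (x : R) : R := \1_(`[0, 1]%classic : set R) x * f0 x.

Lemma truncatedE x : 0 <= x <= 1 -> f0 x = truncated x.
Proof. by move=> x01; rewrite /truncated indicE mem_set ?mul1r//= in_itv. Qed.

Lemma measurable_truncated : measurable_fun setT truncated.
Proof.
apply: (@measurable_fun_cvg _ _ R setT (fun n (x : measurableTypeR R) =>
  \1_(`[0, 1]%classic : set R) x * \sum_(1 <= k < n) b k * psi k x)).
  move=> n; apply: measurable_funM; first by apply: measurable_indic; exact: measurable_itv.
  by apply: measurable_sum => k; apply: measurable_funM => //; exact: measurable_psi.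
move=> x _; rewrite /truncated indicE; case: (boolP (x \in _)) => x01.
  rewrite mul1r; under eq_fun do rewrite mul1r.
  by apply: f0_lim; move: x01; rewrite inE.
by rewrite mul0r; under eq_fun do rewrite mul0r; exact: cvg_cst.
Qed.

Lemma weighted_partial_sum_le m n :
  \sum_(m.+1 <= k < n) k%:R `^ alpha * `|b k| <= Q.
Proof.
have t0 k : (0 <= (k%:R `^ alpha * `|b k|)%:E)%E by rewrite lee_fin mulr_ge0 ?powR_ge0.
have [mn|nm] := leqP m.+1 n; last by rewrite big_geq ?ltW// ltnW.
rewrite -lee_fin (le_trans _ b_sum)//.
rewrite (@nneseries_split _ _ 1 m)// add1n.
rewrite (@nneseries_split _ _ m.+1 (n - m.+1))// subnKC//.
rewrite -sumEFin -[leLHS]add0e; apply: leeD; first by apply: sume_ge0.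
by rewrite -[leLHS]adde0; apply: leeD => //; apply: nneseries_ge0.
Qed.

Lemma coefficient_le k : (0 < k)%N -> `|b k| <= Q.
Proof.
case: k => // k _; have := weighted_partial_sum_le k k.+2.
rewrite big_nat1; apply: le_trans; rewrite ler_peMl//.
apply: (@le_trans _ _ (1 `^ alpha)); first by rewrite powR1.
by apply: ge0_ler_powR; rewrite ?nnegrE ?(ltW alpha_gt0) ?ler1n.
Qed.

(** For [k > m] the weight [k ^ alpha] is at least [m ^ alpha], and [|psi k| <= 1]: the weighted
    absolute sum yields a bound uniform in [x]. *)
Lemma partial_sum_tail_le m n x : (0 < m)%N ->
  `|\sum_(m.+1 <= k < n) b k * psi k x| <= Q * m%:R `^ (- alpha).
Proof.
move=> m0; have mp : 0 < m%:R `^ alpha by rewrite powR_gt0// ltr0n.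
rewrite powRN ler_pdivlMr//.
apply: le_trans (weighted_partial_sum_le m n).
rewrite (le_trans (ler_wpM2r (ltW mp) (ler_norm_sum _ _ _)))// mulr_suml.
apply: ler_sum_nat => k /andP[mk _]; rewrite mulrC normrM.
rewrite ler_pM ?powR_ge0 ?mulr_ge0//; last by rewrite ler_piMr// psi_le1.
by apply: ge0_ler_powR; rewrite ?nnegrE ?(ltW alpha_gt0) ?ler_nat// ltnW.
Qed.

Lemma truncation_error m x : (0 < m)%N -> 0 <= x <= 1 ->
  `|f0 x - \sum_(1 <= k < m.+1) b k * psi k x| <= Q * m%:R `^ (- alpha).
Proof.
move=> m0 x01; set e := Q * _; set S := \sum_(1 <= k < m.+1) _.
have cv : `|\sum_(1 <= k < n) b k * psi k x - S| @[n --> \oo] --> `|f0 x - S|.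
  apply: cvg_norm; apply: cvgB; last exact: cvg_cst.
  by apply: f0_lim; rewrite in_itv.
apply: (cvgr_to_le cv); exists m.+1 => // n /= mn.
rewrite (@big_cat_nat _ _ _ m.+1)//= addrAC subrr add0r.
exact: partial_sum_tail_le.
Qed.

End regression_function.

(** * Rates *)

Section fixed_sample_size.
Context (R : realType) (sigma : R) (piN : nat -> {nonneg R}).
Context (G : probability (measurableTypeR R) R).
Hypothesis sigma_gt0 : 0 < sigma.
Hypothesis piN_sum1 : (\sum_(1 <= m <oo) ((piN m)%:num)%:E = 1)%E.
Variables (alpha Q : R) (f0 : R -> R) (b0 : nat -> R).
Hypotheses (alpha_gt0 : 0 < alpha) (Q_gt0 : 0 < Q).
Hypothesis f0_lim : forall x : R, x \in `[0, 1] ->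
      \sum_(1 <= k < n) b0 k * psi k x @[n --> \oo] --> f0 x.
Hypothesis b0_sum : (\sum_(1 <= k <oo) (k%:R `^ alpha * `|b0 k|)%:E <= Q%:E)%E.

(** Rounding the coefficients costs [eta] each and dropping the tail of [f0] costs the bias. With
    [c = b0] this serves the prior neighbourhood, with [c] a grid point the cells. *)
Lemma box_error m (c : nat -> R) (eta : R) (b : coefs R) x : (0 < m)%N ->
  box m c eta b -> 0 <= x <= 1 ->
  `|series_fun b x - truncated f0 x - \sum_(1 <= k < m.+1) (c k - b0 k) * psi k x| <=
  m%:R * eta + Q * m%:R `^ (- alpha).
Proof.
move=> m0 [bm bc] x01; rewrite -truncatedE// (series_funE _ bm).
have -> : \sum_(1 <= k < m.+1) b k * psi k x - f0 x -
    \sum_(1 <= k < m.+1) (c k - b0 k) * psi k x =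
  \sum_(1 <= k < m.+1) (b k - c k) * psi k x -
  (f0 x - \sum_(1 <= k < m.+1) b0 k * psi k x).
  have E (u v : nat -> R) : \sum_(1 <= k < m.+1) (u k - v k) * psi k x =
     \sum_(1 <= k < m.+1) u k * psi k x - \sum_(1 <= k < m.+1) v k * psi k x.
    by rewrite -sumrB; apply: eq_bigr => k _; rewrite mulrBl.
  by rewrite !E; ring.
rewrite (le_trans (ler_normB _ _))// lerD//; last exact: truncation_error.
rewrite (le_trans (ler_norm_sum _ _ _))//.
apply: (@le_trans _ _ (\sum_(1 <= k < m.+1) eta)).
  apply: ler_sum_nat => k km; rewrite normrM -[leRHS]mulr1 ler_pM ?psi_le1//.
  exact: bc.
by rewrite sumr_const_nat subn1 mulr_natl.
Qed.

Variables (n m m' A : nat).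
Hypotheses (n_gt0 : (0 < n)%N) (m_gt0 : (0 < m)%N) (mm' : (m <= m')%N).

(** Coordinate [i.+1] is a node of the grid of mesh [1 / n] on [- n^A, n^A], which has [2 n^A n + 1]
    nodes; coordinate 0 and those beyond [m'] are 0. *)
Definition grid_center (j : {ffun 'I_m' -> 'I_(2 * n ^ A * n).+1}) (k : nat) : R :=
  if k is i.+1 then
    if insub i is Some l then - (n ^ A)%:R + (j l : nat)%:R / n%:R else 0
  else 0.

Let nR : (0 : R) < n%:R. Proof. by rewrite ltr0n. Qed.

Lemma grid_center_le j k : `|grid_center j k| <= (n ^ A)%:R.
Proof.
case: k => [|i]; first by rewrite /= normr0.
rewrite /=; case: insubP => [l _ _| _]; last by rewrite normr0.
have jo : (j l : nat)%:R / n%:R <= 2 * (n ^ A)%:R :> R.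
  by rewrite ler_pdivrMr// -natrM -natrM ler_nat -ltnS.
have j0 : 0 <= (j l : nat)%:R / n%:R :> R by rewrite divr_ge0.
by rewrite ler_norml; apply/andP; split; lra.
Qed.

Lemma grid_cover (b : coefs R) : box m' (fun=> 0) (n ^ A)%:R b ->
  exists j, box m' (grid_center j) n%:R^-1 b.
Proof.
move=> [bm bB].
pose y (i : nat) := (b i.+1 + (n ^ A)%:R) * n%:R.
exists [ffun i : 'I_m' => inord (Num.truncn (y i))]; split => //.
move=> [//|i] im.
have im' : (i < m')%N by [].
rewrite /=; case: insubP => [l _ li|]; last by rewrite im'.
rewrite ffunE li.
have := bB i.+1 im; rewrite subr0 ler_norml => /andP[b1 b2].
have y0 : 0 <= y i by rewrite mulr_ge0// -lerBlDr sub0r.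
have yM : y i <= (2 * n ^ A * n)%:R.
  by rewrite /y natrM ler_wpM2r// natrM; lra.
rewrite inordK; last first.
  by rewrite ltnS -(ler_nat R) (le_trans _ yM)// Num.Theory.truncn_le.
have /andP[t1 t2] := Num.Theory.truncn_itv y0.
have -> : b i.+1 - (- (n ^ A)%:R + (Num.truncn (y i))%:R / n%:R) =
    (y i - (Num.truncn (y i))%:R) / n%:R.
  by rewrite /y; field; rewrite gt_eqF.
rewrite ger0_norm; last by rewrite divr_ge0// subr_ge0.
rewrite ler_pdivrMr// mulVf ?gt_eqF// lerBlDr.
by rewrite -natr1 in t2; lra.
Qed.

(** [p] bounds the prior mass of the neighbourhood from below, [e1] and [e2] bound the tails of the
    dimension and of a coefficient, [s] bounds the error both on the neighbourhood and on the cells,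
    and [lam] is the margin in the evidence threshold. *)
Variables (D : nat) (delta p e1 e2 s L r lam : R).
Hypotheses (delta_ge0 : 0 <= delta).
Hypothesis deltaG : forall k, (1 <= k <= m)%N ->
  (delta%:E <= G [set x | (`|x - b0 k| <= n%:R^-1)%R])%E.
Hypotheses (p_gt0 : 0 < p) (p_le : p <= (piN m)%:num * delta ^+ m).
Hypothesis e1P : (\sum_(m'.+1 <= N <oo) ((piN N)%:num)%:E <= e1%:E)%E.
Hypothesis e2P : (G [set x | ((n ^ A)%:R < `|x|)%R] <= e2%:E)%E.
Hypotheses (s1 : m%:R / n%:R + Q * m%:R `^ (- alpha) <= s).
Hypotheses (s2 : m'%:R / n%:R + Q * m'%:R `^ (- alpha) <= s).
Hypotheses (L8 : 8 ^+ D.+1 <= L) (r_ge0 : 0 <= r).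
Hypothesis L_large : m'%:R * ((n ^ A)%:R + Q) * (m'%:R * pi) ^+ D <
  Num.sqrt (16 * sigma ^+ 2) * (L / 8 ^+ D) ^+ D.

Let A_r := [set f : R -> R | (r%:E < L2norm (f \- f0)%R)%E].

Let PiP := prob_of (prior_setT G piN_sum1).

Let Fc : set (coefs R) := ~` box m' (fun=> 0) (n ^ A)%:R.

Lemma prior_sieve_compl_le : (PiP Fc <= (e1 + m'%:R * e2)%:E)%E.
Proof.
have B0 : (0 : R) <= (n ^ A)%:R by [].
have mtail k : measurable [set b : coefs R | (n ^ A)%:R < `|b k|].
  rewrite -[X in measurable X]setTI.
  apply: (@measurable_coef R k measurableT [set x : measurableTypeR R | (n ^ A)%:R < `|x|]).
  rewrite (_ : [set x | _] = ~` `[- (n ^ A)%:R, (n ^ A)%:R]).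
    by apply: measurableC; exact: measurable_itv.
  apply/seteqP; split => x /=; rewrite in_itv/= -ler_norml => h.
    by apply/negP; rewrite -ltNge.
  by rewrite ltNge; apply/negP.
have mD : measurable (~` dim_le (R := R) m').
  by apply: measurableC; exact: measurable_dim_le.
(* Union bound: index 0 stands for too large a dimension, index [k >= 1] for a large [k]-th
   coefficient. *)
pose S k : set (coefs R) := if k is j.+1 then [set b | (n ^ A)%:R < `|b j.+1|] else ~` dim_le m'.
have mS k : measurable (S k) by case: k => [|k]; [exact: mD|exact: mtail].
have sub : Fc `<=` \big[setU/set0]_(k < m'.+1) S k.
  move=> b nb; rewrite -(bigcup_mkord m'.+1 S).
  have [bm|] := pselect (dim_le m' b); last by exists 0%N.
  apply: contrapT => nU; apply: nb; split => // -[|k] km //.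
  rewrite subr0 leNgt; apply/negP => bk; apply: nU; by exists k.+1.
have mFc : measurable Fc by apply: measurableC; exact: measurable_box.
have := @content_subadditive _ _ _ PiP Fc S m'.+1 (fun k _ => mS k) mFc sub.
move=> /le_trans; apply.
rewrite big_ord_recl EFinD; apply: leeD; first exact: le_trans (prior_dim_gt _ _ _) e1P.
apply: (@le_trans _ _ (\sum_(k < m') e2%:E)%E).
  by apply: lee_sum => k _; apply: le_trans e2P; exact: prior_tail_coef.
by rewrite sumEFin sumr_const card_ord mulr_natl.
Qed.

Let B := box m b0 n%:R^-1.

Lemma prior_neighbourhood_ge : (p%:E <= PiP B)%E.
Proof.
have := @prior_box_ge R piN G m b0 n%:R^-1 delta m_gt0 delta_ge0 deltaG.
by apply: le_trans; rewrite lee_fin.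
Qed.

Lemma expected_posterior_rate :
  ('E_(design_noise sigma n)[fun w =>
         posterior sigma (random_series_prior piN G) (data f0 w) A_r] <=
   (expR (- lam) + p^-1 * expR (n%:R * (s ^+ 2 / sigma ^+ 2) + lam) * (e1 + m'%:R * e2) +
    ((2 * n ^ A * n).+1 ^ m')%:R *
     ((1 + p^-1 * expR (n%:R * (s ^+ 2 / sigma ^+ 2) * 2 + lam)) *
      expR (- (n%:R *
        (Num.min ((r ^+ 2 / 2 - s ^+ 2) / (16 * sigma ^+ 2)) (8 * L)^-1 / 2)))))%:E)%E.
Proof.
set x := n%:R * (s ^+ 2 / sigma ^+ 2).
have PBf : PiP B \is a fin_num by apply: fin_num_measure; exact: measurable_box.
have PB : p <= fine (PiP B) by rewrite -lee_fin fineK// prior_neighbourhood_ge.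
have PB0 : 0 < fine (PiP B) by exact: lt_le_trans PB.
(* This threshold makes the evidence term exactly [exp (- lam)]. *)
pose t := fine (PiP B) * expR (- (x + lam)).
have t0 : 0 < t by rewrite mulr_gt0 ?expR_gt0.
have tV : t^-1 <= p^-1 * expR (x + lam).
  by rewrite /t invfM -expRN opprK ler_wpM2r ?expR_ge0// lef_pV2 ?posrE.
have m'_gt0 : (0 < m')%N by exact: leq_trans mm'.
(* Only cells that contain a series far from [f0] are kept, since the centres of these alone have a
   large L2 norm. *)
pose hit (j : {ffun 'I_m' -> 'I_(2 * n ^ A * n).+1}) : bool :=
  `[< exists b : coefs R, [/\ finite_dim b, box m' (grid_center j) n%:R^-1 b & A_r (rseries b)] >].
pose J : finType := {j | hit j}.
pose pj (j : J) := tpoly (fun k => grid_center (val j) k - b0 k) m' 0.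
pose Cj (j : J) := box m' (grid_center (val j)) n%:R^-1.
have err (j : J) b z : Cj j b -> 0 <= z <= 1 ->
    `|series_fun b z - truncated f0 z - pj j z| <= s.
  move=> Cb z01; rewrite /pj tpolyE; apply: le_trans s2.
  exact: box_error.
pose rho := expR (- (Num.min ((r ^+ 2 / 2 - s ^+ 2) / (16 * sigma ^+ 2)) (8 * L)^-1 / 2)).
have p_rho (j : J) : (\int[@lebesgue_measure R]_(z in `[0%R, 1%R])
    (expR (- (pj j z ^+ 2 / (16 * sigma ^+ 2))))%:E <= rho%:E)%E.
  apply: (@affinity_bound R _ m' D ((n ^ A)%:R + Q)) => //.
  - move=> k /andP[k0 _]; rewrite (le_trans (ler_normB _ _))// lerD ?grid_center_le//.
    exact: (coefficient_le alpha_gt0 Q_gt0 b0_sum).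
  - by rewrite addr_ge0// ltW.
  - by rewrite mulr_gt0// exprn_gt0.
  have /asboolP[b [[M _ bM] Cb Ab]] := valP j.
  have {}Ab := L2norm_gt r_ge0 Ab.
  have mpj : measurable_fun setT (pj j).
    by apply: continuous_measurable_fun; exact: continuous_tpoly.
  set I := (\int[_]_(_ in _) _)%E.
  (* From [u ^+ 2 <= 2 * v ^+ 2 + 2 * (u - v) ^+ 2] with [v] the centre; this is the source of
     [r ^+ 2 / 2 - s ^+ 2]. *)
  have : ((r ^+ 2)%:E <= 2%:E * I + (2 * s ^+ 2)%:E)%E.
    apply: (le_trans Ab).
    apply: (@le_trans _ _ (\int[@lebesgue_measure R]_(z in `[0%R, 1%R])
      (2%:E * (pj j z ^+ 2)%:E + (2 * s ^+ 2)%:E))%E).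
      apply: ge0_le_integral_nonmeasurable => z; first by rewrite lee_fin sqr_ge0.
      rewrite /= in_itv/= => z01; rewrite -EFinM -EFinD lee_fin.
      have {}err := err j b z Cb z01; move: err.
      rewrite -truncatedE// /series_fun indicE mem_set ?mul1r; last by exists M.
      move=> e; have e2' : (rseries b z - f0 z - pj j z) ^+ 2 <= s ^+ 2.
        rewrite -(real_normK (num_real (rseries b z - f0 z - pj j z))) lerXn2r ?nnegrE//.
        by rewrite (le_trans _ e).
      have : 0 <= (rseries b z - f0 z - 2 * pj j z) ^+ 2 by exact: sqr_ge0.
      rewrite /=; move: (rseries b z - f0 z) (pj j z) e2' => u v; nra.
    rewrite ge0_integralD//=.
    - rewrite ge0_integralZl//=; last 2 first.
        by apply/measurable_EFinP; apply: measurable_funX; exact: measurable_funTS.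
        by move=> z _; rewrite lee_fin sqr_ge0.
      by rewrite integral_cst//= lebesgue_measure_itv/= lte_fin ltr01 oppr0 adde0 mule1.
    - by move=> z _; rewrite -EFinM lee_fin mulr_ge0 ?sqr_ge0.
    - by apply: measurable_funeM; apply/measurable_EFinP; apply: measurable_funX;
        exact: measurable_funTS.
    - by move=> z _; rewrite lee_fin mulr_ge0 ?sqr_ge0.
  have I0 : (0 <= I)%E by apply: integral_ge0 => z _; rewrite lee_fin sqr_ge0.
  have [->|Iy] := eqVneq I +oo%E; first by rewrite leey.
  have If : I \is a fin_num by rewrite ge0_fin_numE// ltey.
  by rewrite -(fineK If) -EFinM -EFinD !lee_fin; lra.
have ETb (b : coefs R) : finite_dim b -> rseries b = series_fun b.
  by move=> Eb; apply/funext => z; rewrite /series_fun indicE mem_set ?mul1r.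
have mB : measurable B by exact: measurable_box.
have BE : B `<=` finite_dim (R := R) by move=> b [bm _]; exists m.
have PB0' : (0 < PiP B)%E by rewrite -(fineK PBf) lte_fin.
have Bs (b : coefs R) z : B b -> 0 <= z <= 1 -> `|series_fun b z - truncated f0 z| <= s.
  move=> Bb z01; apply: le_trans s1; have := box_error m_gt0 Bb z01.
  by rewrite [X in _ - X]big1 ?subr0// => k _; rewrite subrr mul0r.
have mFc : measurable Fc by apply: measurableC; exact: measurable_box.
have mC j : measurable (Cj j) by exact: measurable_box.
have cover (b : coefs R) : finite_dim b -> A_r (rseries b) -> Fc b \/ exists j, Cj j b.
  move=> Eb Ab; have [Bb|] := pselect (box m' (fun=> 0) (n ^ A)%:R b); last by left.
  have [j Cb] := grid_cover Bb; right.
  have hj : hit j by apply/asboolP; exists b.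
  by exists (exist _ j hj).
have mp (j : J) : measurable_fun setT (pj j).
  by apply: continuous_measurable_fun; exact: continuous_tpoly.
have main := @expected_posterior_le R sigma sigma_gt0 PiP n f0 (truncated f0)
  (@series_fun R) (@finite_dim R) B Fc J Cj pj A_r s s t rho
  (@measurable_series_fun R) (measurable_truncated f0_lim) (truncatedE f0)
  (@measurable_finite_dim R) (prior_infinite_dim piN G) ETb mB BE PB0' Bs mFc mC cover
  mp err p_rho t0.
apply: (le_trans main); rewrite lee_fin -/x.
have PF : fine (PiP Fc) <= e1 + m'%:R * e2.
  by rewrite -lee_fin fineK ?prior_sieve_compl_le//; apply: fin_num_measure.
have PF0 : 0 <= fine (PiP Fc) by exact: fine_ge0.
have tV0 : 0 <= t^-1 by rewrite invr_ge0 ltW.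
apply: lerD; [apply: lerD|].
- rewrite le_eqVlt; apply/orP; left; apply/eqP.
  by rewrite /t (mulrC (fine _)) mulfK ?gt_eqF// -expRD; congr expR; rewrite opprD
      addrAC addNr add0r.
- by apply: ler_pM.
have cJ : (#|J| <= (2 * n ^ A * n).+1 ^ m')%N.
  by rewrite card_sig (leq_trans (max_card _))// card_ffun !card_ord.
have r0 : 0 <= rho ^+ n by rewrite exprn_ge0// expR_ge0.
have -> : expR (- (n%:R * (Num.min ((r ^+ 2 / 2 - s ^+ 2) / (16 * sigma ^+ 2)) (8 * L)^-1 / 2))) =
  rho ^+ n by rewrite -mulrN expRM_natl.
apply: ler_pM => //.
- by rewrite mulr_ge0// addr_ge0// mulr_ge0// expR_ge0.
- by rewrite ler_nat.
rewrite ler_wpM2r// lerD2l (_ : x * 2 + lam = x + lam + x); last by ring.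
by rewrite expRD mulrA ler_wpM2r ?expR_ge0.
Qed.

End fixed_sample_size.

(** * Growth of logarithms, powers and the effective dimension *)

Section growth.
Context (R : realType).

Lemma gt0_powRD (x r s : R) : 0 < x -> x `^ (r + s) = x `^ r * x `^ s.
Proof. by move=> x0; apply: powRD; apply/implyP => _; rewrite gt_eqF. Qed.

Lemma near_ln_ge (C : R) : \forall n \near \oo, C <= ln (n%:R : R).
Proof.
near=> n; rewrite -[C]expRK ler_ln ?posrE ?expR_gt0 ?ltr0n//.
  by near: n; exact: nbhs_infty_ger.
by near: n; exact: nbhs_infty_gt.
Unshelve. all: by end_near. Qed.

Lemma near_powR_ge (q C : R) : 0 < q -> \forall n \near \oo, C <= (n%:R : R) `^ q.
Proof.
move=> q0; near=> n.
have n0 : (0 : R) < n%:R by rewrite ltr0n; near: n; exact: nbhs_infty_gt.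
have := expR_ge1Dx (q * ln n%:R); rewrite /powR gt_eqF//; apply: le_trans.
have : C / q <= ln (n%:R : R) by near: n; exact: near_ln_ge.
by rewrite ler_pdivrMr// mulrC; lra.
Unshelve. all: by end_near. Qed.

(** Half of the power beats the logarithm, the other half the constant. *)
Lemma near_ln_le_powR (q C : R) : 0 < q -> \forall n \near \oo,
  C * ln (n%:R : R) <= n%:R `^ q.
Proof.
move=> q0; near=> n.
have n0 : (0 : R) < n%:R by rewrite ltr0n; near: n; exact: nbhs_infty_gt.
have l0 : 0 <= ln (n%:R : R) by near: n; exact: near_ln_ge.
have C1 : `|C| * 2 / q <= n%:R `^ (q / 2) :> R.
  by near: n; apply: near_powR_ge; rewrite divr_gt0.
have -> : n%:R `^ q = n%:R `^ (q / 2) * n%:R `^ (q / 2) :> R.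
  by rewrite -gt0_powRD// -splitr.
have lq : ln (n%:R : R) <= 2 / q * n%:R `^ (q / 2).
  rewrite -ler_pdivrMl ?divr_gt0// invf_div.
  have := expR_ge1Dx (q / 2 * ln (n%:R : R)); rewrite /powR gt_eqF//; lra.
apply: (@le_trans _ _ (`|C| * ln n%:R)); first by rewrite ler_wpM2r// ler_norm.
apply: (@le_trans _ _ (`|C| * (2 / q * n%:R `^ (q / 2)))); first by rewrite ler_wpM2l.
by rewrite mulrA ler_wpM2r ?powR_ge0// mulrA.
Unshelve. all: by end_near. Qed.

Lemma near_ln_powR_ge (q C : R) : 0 < q -> \forall n \near \oo,
  C <= ln (n%:R : R) `^ q.
Proof.
move=> q0; near=> n.
have l1 : expR (C / q) <= ln (n%:R : R) by near: n; exact: near_ln_ge.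
have l0 : 0 < ln (n%:R : R) by apply: lt_le_trans l1; exact: expR_gt0.
have := expR_ge1Dx (q * ln (ln n%:R)); rewrite /powR gt_eqF//; apply: le_trans.
have : C / q <= ln (ln (n%:R : R)) by rewrite -[C / q]expRK ler_ln ?posrE ?expR_gt0.
by rewrite ler_pdivrMr// mulrC; lra.
Unshelve. all: by end_near. Qed.

Variable nu : R.
Hypotheses (nu_gt0 : 0 < nu) (nu_lt : nu < 2^-1).

(* The effective dimension: up to constants, X terms of the series balance
   bias and prior mass. *)
Definition dim_scale (n : nat) : R := (n%:R / ln n%:R) `^ nu.

(** Eventually [ln n <= n ^ (1/2)], so [n / ln n >= n ^ (1/2)] and the scale is at least
    [n ^ (nu / 2)]. *)
Lemma near_dim_scale_ge (C : R) : \forall n \near \oo, C <= dim_scale n.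
Proof.
near=> n.
have n0 : (0 : R) < n%:R by rewrite ltr0n; near: n; exact: nbhs_infty_gt.
have l1 : 1 <= ln (n%:R : R) by near: n; exact: near_ln_ge.
have h : 1 * ln (n%:R : R) <= n%:R `^ 2^-1 by near: n; apply: near_ln_le_powR.
have C1 : C <= n%:R `^ (2^-1 * nu) :> R by near: n; apply: near_powR_ge; rewrite mulr_gt0.
apply: (le_trans C1); rewrite powRrM /dim_scale; apply: ge0_ler_powR.
- exact: ltW.
- by rewrite nnegrE powR_ge0.
- by rewrite nnegrE divr_ge0// (le_trans ler01).
rewrite ler_pdivlMr; last by rewrite (lt_le_trans ltr01).
apply: (@le_trans _ _ (n%:R `^ 2^-1 * n%:R `^ 2^-1)).
  by rewrite ler_wpM2l ?powR_ge0// -[leLHS]mul1r.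
rewrite -gt0_powRD//.
by rewrite (_ : 2^-1 + 2^-1 = 1) ?powRr1 ?(ltW n0)//; lra.
Unshelve. all: by end_near. Qed.

(** The scale is at most [n ^ nu], so the left side is of order at most [n ^ (2 nu + kap) ln n], and
    the remaining power of [n] beats the logarithm. *)
Lemma near_scale_le (kap C : R) : 2 * nu + kap < 1 -> 0 <= C -> \forall n \near \oo,
  C * (dim_scale n ^+ 2 * ln n%:R * n%:R `^ kap) <= n%:R.
Proof.
move=> nk C0; near=> n.
have n0 : (0 : R) < n%:R by rewrite ltr0n; near: n; exact: nbhs_infty_gt.
have l1 : 1 <= ln (n%:R : R) by near: n; exact: near_ln_ge.
have h : C * ln (n%:R : R) <= n%:R `^ (1 - (2 * nu + kap)).
  by near: n; apply: near_ln_le_powR; rewrite subr_gt0.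
have X0 : 0 <= dim_scale n by exact: powR_ge0.
have Xn : dim_scale n <= n%:R `^ nu.
  apply: ge0_ler_powR; rewrite ?nnegrE ?(ltW nu_gt0) ?(ltW n0)//.
    by rewrite divr_ge0// (le_trans ler01).
  by rewrite ler_pdivrMr ?(lt_le_trans ltr01)// ler_peMr// ltW.
have X2 : dim_scale n ^+ 2 <= n%:R `^ (2 * nu).
  rewrite mulrC powRrM powR_mulrn ?powR_ge0// lerXn2r ?nnegrE// powR_ge0//.
have E : n%:R `^ (1 - (2 * nu + kap)) * (n%:R `^ (2 * nu) * n%:R `^ kap) = n%:R :> R.
  rewrite -!gt0_powRD//.
  have -> : 1 - (2 * nu + kap) + (2 * nu + kap) = 1 by ring.
  by rewrite powRr1// ltW.
rewrite -[leRHS]E.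
have -> : C * (dim_scale n ^+ 2 * ln n%:R * n%:R `^ kap) =
  (C * ln n%:R) * (dim_scale n ^+ 2 * n%:R `^ kap) by ring.
apply: ler_pM => //.
- by rewrite mulr_ge0// (le_trans ler01).
- by rewrite mulr_ge0 ?powR_ge0// exprn_ge0.
by rewrite ler_wpM2r// powR_ge0.
Unshelve. all: by end_near. Qed.

End growth.

Lemma grid_size_le (A n : nat) : (2 <= n)%N ->
  ((2 * n ^ A * n).+1 <= n ^ (A + 3))%N.
Proof.
move=> n2; have nn : (4 <= n * n)%N by rewrite (@leq_mul 2 2).
have : (1 <= n ^ A * n)%N by rewrite muln_gt0 expn_gt0 !(leq_trans _ n2).
rewrite (_ : n ^ (A + 3) = n ^ A * n * (n * n))%N; last by rewrite expnD -mulnA.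
rewrite -mulnA; move: (n ^ A * n)%N (n * n)%N nn => u v v4 u1.
by rewrite (leq_trans _ (leq_mul (leqnn u) v4))//; lia.
Qed.

(** * Choice of the parameters *)

Section rate.
Context (R : realType) (sigma : R) (piN : nat -> {nonneg R}).
Context (G : probability (measurableTypeR R) R).
Hypothesis sigma_gt0 : 0 < sigma.
Hypothesis piN_sum1 : (\sum_(1 <= m <oo) ((piN m)%:num)%:E = 1)%E.
Variables (b0 b1 : R).
Hypotheses (b0_gt0 : 0 < b0) (b1_gt0 : 0 < b1).
Hypothesis piN_lower : forall m : nat, (2 <= m)%N ->
      expR (- (b0 * m%:R * ln m%:R)) <= (piN m)%:num.
Hypothesis piN_tail : forall m : nat, (2 <= m)%N ->
      (\sum_(m.+1 <= N <oo) ((piN N)%:num)%:E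
        <= (expR (- (b1 * m%:R * ln m%:R)))%:E)%E.
Variables (alpha Q : R) (f0 : R -> R) (beta : nat -> R).
Hypotheses (alpha_gt : 2^-1 < alpha) (Q_gt0 : 0 < Q).
Hypothesis f0_lim : forall x : R, x \in `[0, 1] ->
      \sum_(1 <= k < n) beta k * psi k x @[n --> \oo] --> f0 x.
Hypothesis beta_sum : (\sum_(1 <= k <oo) (k%:R `^ alpha * `|beta k|)%:E <= Q%:E)%E.
Variables (gm K tau tau0 : R).
Hypotheses (gm_gt0 : 0 < gm) (K_gt0 : 0 < K) (tau0_gt0 : 0 < tau0).
Hypothesis G_interval : forall k eta, (1 <= k)%N -> 0 < eta <= 1 ->
  ((2 * eta * gm)%:E <= G [set x | (`|x - beta k| <= eta)%R])%E.
Hypothesis G_tail : forall B, 0 <= B ->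
  (G [set x | (B < `|x|)%R] <= (K * expR (- (tau0 / 2 * B `^ tau)))%:E)%E.

Let nu := (2 * alpha + 1)^-1.
Let a := alpha / (2 * alpha + 1).
(** The sieve has dimension [kap * m] and coefficients up to [n ^ A]. In units of [Lam = X * l]:
    [c1] is the exponent of the inverse prior mass ([2 * b0] from [piN], 4 from the [m] intervals),
    [S] bounds [n * s ^+ 2], [c2] is the exponent of the factor before the sieve complement, and
    [c3] collects the number of cells and the factor on their affinity. *)
Variables (kap A D : nat) (kp t : R).
Let c1 := 2 * b0 + 4.
Let S := 2 + 2 * Q ^+ 2.
Let S' := S / sigma ^+ 2.
Let c2 := c1 + S' + 1.
Let c3 := (A%:R + 3) * (2 * kap%:R) + c1 + 2 * S' + 1.
Hypotheses (kap_gt0 : (0 < kap)%N) (hA : 1 <= A%:R * tau).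
Hypothesis hkap : 2 * (c2 + 1) <= kap%:R * (b1 * nu).
Hypotheses (kp_gt0 : 0 < kp) (hD : A%:R + 3 <= kp * D%:R).

Variable n : nat.
Let l : R := ln n%:R.
Let X := dim_scale nu n.
Let Lam := X * l.
Hypotheses (n2 : (2 <= n)%N) (l1 : 1 <= l) (X8 : 8 <= X).
Hypothesis l_sqrt : l <= n%:R `^ 2^-1.
(** [big1] controls the dimension and the discretisation error, [big2] the coefficient tails, [big3]
    the affinity of centres with a large maximum. *)
Hypothesis big1 : 4 * kap%:R ^+ 2 * (X ^+ 2 * l * n%:R `^ kp) <= n%:R.
Hypothesis big2 : 2 * (c2 + 1 + 2 * kap%:R + K) / tau0 * (X ^+ 2 * l * n%:R `^ kp) <= n%:R.
Hypothesis big3 : 32 * 8 ^+ D * pi * kap%:R * (c3 + 1) * (X ^+ 2 * l * n%:R `^ kp) <= n%:R.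
Hypotheses (n_gm : (2 * gm)^-1 <= n%:R) (n_Q : Q <= n%:R) (n_sigma : (2 * sigma)^-1 < n%:R).
Hypothesis ht : 2 * (32 * sigma ^+ 2 * (c3 + 1) + S) <= l `^ (2 * (t - a)).

Let m := (Num.truncn X).+1.
Let m' := (kap * m)%N.

Let alpha_gt0 : 0 < alpha. Proof. by apply: lt_trans alpha_gt; rewrite invr_gt0. Qed.
Let al1 : 0 < 2 * alpha + 1. Proof. by move: alpha_gt0; lra. Qed.
Let nu_gt0 : 0 < nu. Proof. by rewrite invr_gt0. Qed.
Let nu_a : nu + 2 * a = 1.
Proof. by rewrite /nu /a; field; rewrite gt_eqF. Qed.
Let alnu : alpha * nu = a. Proof. by []. Qed.
Let n0 : (0 : R) < n%:R. Proof. by rewrite ltr0n (leq_trans _ n2). Qed.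
Let n1 : (1 : R) <= n%:R. Proof. by rewrite ler1n (leq_trans _ n2). Qed.
Let l0 : 0 < l. Proof. exact: lt_le_trans l1. Qed.
Let X0 : 0 < X. Proof. exact: lt_le_trans X8. Qed.
Let Lam_X : X <= Lam. Proof. by rewrite /Lam ler_peMr// ltW. Qed.
Let Lam0 : 0 < Lam. Proof. by rewrite mulr_gt0. Qed.
Let Lam1 : 1 <= Lam. Proof. by apply: le_trans Lam_X; move: X8; lra. Qed.
Let nkp : 1 <= n%:R `^ kp :> R.
Proof.
apply: (@le_trans _ _ (n%:R `^ 0)); first by rewrite powRr0.
by apply: ler_powR => //; exact: ltW.
Qed.
Let kapR : 1 <= kap%:R :> R. Proof. by rewrite ler1n. Qed.
Let S0 : 0 <= S. Proof. by rewrite addr_ge0// mulr_ge0// sqr_ge0. Qed.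
Let S'0 : 0 <= S'. Proof. by rewrite divr_ge0// sqr_ge0. Qed.
Let c20 : 0 < c2. Proof. by rewrite /c2 /c1; move: b0_gt0 S'0; lra. Qed.
Let c30 : 0 < c3.
Proof.
have : 0 <= (A%:R + 3) * (2 * kap%:R) :> R by rewrite !mulr_ge0// addr_ge0.
by rewrite /c3 /c1; move: b0_gt0 S'0; lra.
Qed.

Let mX : X <= m%:R.
Proof. exact/ltW/Num.Theory.truncnS_gt. Qed.
Let m2X : m%:R <= 2 * X.
Proof.
have /andP[+ _] := Num.Theory.truncn_itv (ltW X0).
by rewrite /m -natr1; move: X8; lra.
Qed.
Let m'2X : m'%:R <= 2 * kap%:R * X.
Proof.
rewrite /m' natrM (_ : 2 * kap%:R * X = kap%:R * (2 * X)); last by ring.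
by rewrite ler_wpM2l.
Qed.
Let m_m' : (m <= m')%N. Proof. by rewrite /m' leq_pmull. Qed.
Let m_ge2 : (2 <= m)%N.
Proof. by rewrite -(ler_nat R) (le_trans _ mX)// (le_trans _ X8)// ler_nat. Qed.
Let m'_ge2 : (2 <= m')%N. Proof. exact: leq_trans m_m'. Qed.

Let W := X ^+ 2 * l * n%:R `^ kp.
Let Lam_W : Lam <= W.
Proof.
rewrite /Lam /W -[leLHS]mulr1 ler_pM ?(ltW Lam0)// ler_wpM2r ?(ltW l0)//.
by rewrite expr2 ler_peMr ?(ltW X0)//; move: X8; lra.
Qed.
Let X2_W : X ^+ 2 <= W.
Proof. by rewrite /W -mulrA ler_peMr ?sqr_ge0// -[leLHS]mulr1 ler_pM. Qed.

Let m'n : m'%:R <= n%:R :> R.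
Proof.
apply: (le_trans m'2X); apply: le_trans big1.
apply: (@le_trans _ _ (4 * kap%:R ^+ 2 * X ^+ 2)); last first.
  by rewrite ler_wpM2l// mulr_ge0// exprn_ge0.
have z1 : 1 <= kap%:R * X by rewrite -[leLHS]mulr1 ler_pM//; move: X8; lra.
have -> : 4 * kap%:R ^+ 2 * X ^+ 2 = 4 * (kap%:R * X) * (kap%:R * X) by ring.
have -> : 2 * kap%:R * X = 2 * (kap%:R * X) by ring.
by move: (kap%:R * X) z1 => z z1; nra.
Qed.

(** The larger dimension [m'] in the rounding error and the smaller scale [X] in the bias make one
    [s] serve both dimensions. *)
Let s := m'%:R / n%:R + Q * X `^ (- alpha).

Let s_sqr : n%:R * s ^+ 2 <= S * Lam.
Proof.
have h1 : n%:R * (m'%:R / n%:R) ^+ 2 <= Lam.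
  have -> : n%:R * (m'%:R / n%:R) ^+ 2 = m'%:R ^+ 2 / n%:R :> R by field; rewrite gt_eqF.
  rewrite ler_pdivrMr//; apply: (@le_trans _ _ n%:R); last by rewrite ler_peMl// ltW.
  apply: le_trans big1; apply: (@le_trans _ _ (4 * kap%:R ^+ 2 * X ^+ 2)); last first.
    by rewrite ler_wpM2l// mulr_ge0// exprn_ge0.
  have -> : 4 * kap%:R ^+ 2 * X ^+ 2 = (2 * kap%:R * X) ^+ 2 by ring.
  by rewrite lerXn2r ?nnegrE// !mulr_ge0// ltW.
(* The balance that defines [X]: [n * X ^ (- 2 alpha) = X * l]. *)
have h2 : n%:R * (Q * X `^ (- alpha)) ^+ 2 = Q ^+ 2 * Lam.
  have -> : n%:R * (Q * X `^ (- alpha)) ^+ 2 = Q ^+ 2 * (n%:R * (X `^ (- alpha)) ^+ 2) by ring.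
  congr (_ * _); rewrite -powR_mulrn ?powR_ge0// -powRrM /Lam /X /dim_scale -powRrM.
  have nl0 : 0 < n%:R / l by rewrite divr_gt0.
  have -> : nu * (- alpha * 2) = - (1 - nu) by have := nu_a; rewrite -alnu; lra.
  rewrite opprB gt0_powRD// powRN powRr1 ?(ltW nl0)// -/l.
  by field; rewrite !gt_eqF.
have : n%:R * s ^+ 2 <= 2 * (n%:R * (m'%:R / n%:R) ^+ 2) + 2 * (n%:R * (Q * X `^ (- alpha)) ^+ 2).
  rewrite /s; move: (m'%:R / n%:R) (Q * _) => u v.
  rewrite -subr_ge0 (_ : _ - _ = n%:R * (u - v) ^+ 2); first by rewrite mulr_ge0 ?sqr_ge0.
  by ring.
by rewrite h2 /S; lra.
Qed.

Let m0 : (0 : R) < m%:R. Proof. exact: lt_le_trans X0 mX. Qed.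

Let Xm : X `^ (- alpha) >= m%:R `^ (- alpha).
Proof.
rewrite !powRN lef_pV2 ?posrE ?(powR_gt0 _ X0) ?(powR_gt0 _ m0)//.
by apply: ge0_ler_powR; rewrite ?nnegrE ?(ltW alpha_gt0) ?(ltW X0).
Qed.

Let Xm' : X `^ (- alpha) >= m'%:R `^ (- alpha).
Proof.
apply: le_trans Xm.
have mm : m%:R <= m'%:R :> R by rewrite ler_nat.
rewrite !powRN lef_pV2 ?posrE ?(powR_gt0 _ m0) ?(powR_gt0 _ (lt_le_trans m0 mm))//.
by apply: ge0_ler_powR; rewrite ?nnegrE ?(ltW alpha_gt0).
Qed.

Let s1 : m%:R / n%:R + Q * m%:R `^ (- alpha) <= s.
Proof.
by rewrite lerD ?ler_pM2l// ler_pM2r ?invr_gt0// ler_nat.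
Qed.

Let s2 : m'%:R / n%:R + Q * m'%:R `^ (- alpha) <= s.
Proof. by rewrite lerD2l ler_pM2l. Qed.

(** The logarithm of the dimension is comparable to [ln n], which turns the exponent [m ln m] of the
    tail of [piN] into a multiple of [Lam]. *)
Let lnX : nu / 2 * l <= ln (m%:R : R).
Proof.
have nX : n%:R `^ (2^-1 * nu) <= X.
  rewrite powRrM; apply: ge0_ler_powR; rewrite ?nnegrE ?powR_ge0 ?(ltW nu_gt0)//.
    by rewrite divr_ge0// ltW.
  rewrite ler_pdivlMr//; apply: (@le_trans _ _ (n%:R `^ 2^-1 * n%:R `^ 2^-1)).
    by rewrite ler_wpM2l ?powR_ge0.
  rewrite -gt0_powRD// (_ : 2^-1 + 2^-1 = 1) ?powRr1 ?(ltW n0)//; lra.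
apply: (@le_trans _ _ (ln (n%:R `^ (2^-1 * nu)))); first by rewrite ln_powR (mulrC nu).
by rewrite ler_ln ?posrE ?(powR_gt0 _ n0) ?m0// (le_trans nX mX).
Qed.

Let p := expR (- (c1 * Lam)).

Let p_le : p <= (piN m)%:num * (n%:R^-1 ^+ 2) ^+ m.
Proof.
have lm : ln (m%:R : R) <= l.
  rewrite ler_ln ?posrE//.
  by apply: le_trans m'n; rewrite ler_nat.
have lm0 : 0 <= ln (m%:R : R) by rewrite ln_ge0// ler1n.
have h1 : expR (- (2 * b0 * Lam)) <= (piN m)%:num.
  apply: le_trans (piN_lower m_ge2); rewrite ler_expR lerN2.
  rewrite (_ : 2 * b0 * Lam = b0 * (2 * X) * l); last by rewrite /Lam; ring.
  by rewrite ler_pM// ?mulr_ge0 ?(ltW b0_gt0)// ler_pM2l.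
have h2 : expR (- (4 * Lam)) <= (n%:R^-1 ^+ 2) ^+ m.
  have -> : n%:R^-1 = expR (- l) :> R by rewrite expRN lnK.
  rewrite -exprM -expRM_natl ler_expR mulrN lerN2 natrM.
  have : m%:R * l <= 2 * X * l by rewrite ler_pM2r.
  by rewrite /Lam; lra.
rewrite /p /c1 mulrDl opprD expRD.
by apply: ler_pM; rewrite ?expR_ge0.
Qed.

Let x := n%:R * (s ^+ 2 / sigma ^+ 2).

Let x_le : x <= S' * Lam.
Proof.
rewrite /x mulrA (_ : S' * Lam = S * Lam / sigma ^+ 2); last by rewrite /S' mulrAC.
by rewrite ler_wpM2r// invr_ge0 sqr_ge0.
Qed.

Let e1 := expR (- (b1 * m'%:R * ln (m'%:R : R))).
Let e2 := K * expR (- (tau0 / 2 * n%:R)).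

Let e1_le : e1 <= expR (- ((c2 + 1) * Lam)).
Proof.
rewrite ler_expR lerN2.
have h : nu / 2 * l <= ln (m'%:R : R).
  by apply: (le_trans lnX); rewrite ler_ln ?posrE ?(lt_le_trans m0) ?ler_nat.
apply: (@le_trans _ _ (b1 * (kap%:R * X) * (nu / 2 * l))).
  rewrite (_ : b1 * (kap%:R * X) * (nu / 2 * l) = kap%:R * (b1 * nu) / 2 * Lam); last first.
    by rewrite /Lam; field.
  by rewrite ler_pM2r//; move: hkap; lra.
apply: ler_pM => //.
- by rewrite !mulr_ge0// ltW.
- by rewrite !mulr_ge0// ltW.
by rewrite ler_pM2l// /m' natrM ler_wpM2l.
Qed.

Let me2_le : m'%:R * e2 <= expR (- ((c2 + 1) * Lam)).
Proof.
(* The prefactors [m'] and [K] are moved into the exponent, where [n] outweighs every multiple of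
   [Lam]. *)
have hm : m'%:R <= expR (2 * kap%:R * Lam).
  apply: (le_trans m'2X); apply: le_trans (expR_ge1Dx _).
  rewrite -[leLHS]add0r lerD// ler_wpM2l// mulr_ge0//.
have hK : K <= expR (K * Lam).
  apply: le_trans (expR_ge1Dx _).
  by rewrite -[leLHS]add0r lerD// ler_peMr// ltW.
have hn : (c2 + 1 + 2 * kap%:R + K) * Lam <= tau0 / 2 * n%:R.
  have : 2 * (c2 + 1 + 2 * kap%:R + K) / tau0 * Lam <= n%:R.
    apply: le_trans big2; rewrite ler_wpM2l// divr_ge0 ?(ltW tau0_gt0)//.
    by rewrite mulr_ge0//; move: c20 K_gt0 kapR; lra.
  rewrite mulrAC ler_pdivrMr// => h.
  by rewrite mulrAC ler_pdivlMr//; lra.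
apply: (@le_trans _ _ (expR (2 * kap%:R * Lam) * (expR (K * Lam) * expR (- (tau0 / 2 * n%:R))))).
  rewrite ler_pM ?ler_wpM2r ?expR_ge0// mulr_ge0 ?expR_ge0// ltW//.
by rewrite -!expRD ler_expR; lra.
Qed.

Let term2 : p^-1 * expR (x + Lam) * (e1 + m'%:R * e2) <= 2 * expR (- Lam).
Proof.
have -> : p^-1 = expR (c1 * Lam) by rewrite -expRN opprK.
have h : expR (c1 * Lam) * expR (x + Lam) <= expR (c2 * Lam).
  by rewrite -expRD ler_expR /c2; move: x_le; lra.
apply: (@le_trans _ _ (expR (c2 * Lam) * (2 * expR (- ((c2 + 1) * Lam))))).
  rewrite ler_pM ?mulr_ge0 ?expR_ge0//.
    by rewrite addr_ge0 ?mulr_ge0 ?expR_ge0// ltW.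
  by have := lerD e1_le me2_le; lra.
rewrite mulrCA -expRD (_ : c2 * Lam - _ = - Lam)//; ring.
Qed.

Let card_le : ((2 * n ^ A * n).+1 ^ m')%:R <= expR ((A%:R + 3) * (2 * kap%:R) * Lam).
Proof.
have h := grid_size_le A n2.
apply: (@le_trans _ _ ((n ^ (A + 3)) ^ m')%:R).
  by rewrite ler_nat leq_exp2r// (leq_trans _ m'_ge2).
rewrite -expnM natrX -[n%:R]lnK ?posrE// -/l -expRM_natl ler_expR natrM natrD.
rewrite -mulrA -[leRHS]mulrA ler_wpM2l ?addr_ge0// /Lam [leRHS]mulrA.
by rewrite ler_pM2r.
Qed.

(** The factor [8 ^+ D] offsets the losses in Landau's inequality and [pi * m'] matches the largest
    frequency bound, so in [L_large] only [(n ^ kp) ^ D] has to beat a power of [n]. *)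
Let L := 8 ^+ D * (pi * m'%:R * n%:R `^ kp).

Let pi2 : 2 <= pi :> R. Proof. exact: pi_ge2. Qed.
Let m'0 : (0 : R) < m'%:R. Proof. by rewrite ltr0n (leq_trans _ m'_ge2). Qed.

Let L8 : 8 ^+ D.+1 <= L.
Proof.
rewrite exprSr /L ler_wpM2l ?exprn_ge0//.
apply: (le_trans X8); apply: (@le_trans _ _ (1 * m'%:R * 1)).
  by rewrite mul1r mulr1 (le_trans mX)// ler_nat.
by rewrite ler_pM// ler_pM//; move: pi2; lra.
Qed.

Let L_large : m'%:R * ((n ^ A)%:R + Q) * (m'%:R * pi) ^+ D <
  Num.sqrt (16 * sigma ^+ 2) * (L / 8 ^+ D) ^+ D.
Proof.
have -> : Num.sqrt (16 * sigma ^+ 2) = 4 * sigma.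
  rewrite (_ : 16 * sigma ^+ 2 = (4 * sigma) ^+ 2); last by ring.
  by rewrite sqrtr_sqr ger0_norm// mulr_ge0// ltW.
have -> : L / 8 ^+ D = m'%:R * pi * n%:R `^ kp.
  by rewrite /L; field; rewrite expf_neq0.
rewrite [X in _ < _ * X]exprMn [ltRHS]mulrCA [ltLHS]mulrC.
rewrite ltr_pM2l; last by rewrite exprn_gt0// mulr_gt0// pi_gt0.
have nk : n%:R ^+ (A + 3) <= (n%:R `^ kp) ^+ D :> R.
  rewrite -[leLHS](powR_mulrn _ (ltW n0)) -[leRHS](powR_mulrn _ (powR_ge0 _ _)) -powRrM.
  by apply: ler_powR => //; rewrite natrD.
apply: (@lt_le_trans _ _ (4 * sigma * n%:R ^+ (A + 3))); last first.
  by rewrite ler_wpM2l// mulr_ge0// ltW.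
have hA1 : (n ^ A)%:R + Q <= 2 * n%:R ^+ A.+1 :> R.
  have : (n ^ A)%:R <= n%:R ^+ A.+1 :> R by rewrite natrX exprS ler_peMl// exprn_ge0// ltW.
  have : Q <= n%:R ^+ A.+1 by apply: (le_trans n_Q); rewrite exprS ler_peMr ?exprn_ege1// ltW.
  by lra.
apply: (@le_lt_trans _ _ (n%:R * (2 * n%:R ^+ A.+1))).
  by rewrite ler_pM// addr_ge0// ltW.
rewrite (_ : (A + 3)%N = A.+3); last by rewrite addnC.
have -> : 4 * sigma * n%:R ^+ A.+3 = n%:R * (2 * n%:R ^+ A.+1) * (2 * sigma * n%:R).
  by rewrite !exprS; ring.
rewrite ltr_pMr ?mulr_gt0 ?exprn_gt0//.
by move: n_sigma; rewrite -div1r ltr_pdivrMr ?mulr_gt0// mulrC.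
Qed.

Let r := n%:R `^ (- a) * l `^ t.

(** The surplus over [Lam] is a positive power of [l] when [t > a], and absorbs every constant. *)
Let r_sqr : n%:R * r ^+ 2 = Lam * l `^ (2 * (t - a)).
Proof.
rewrite /r exprMn -(powR_mulrn _ (powR_ge0 n%:R _)) -(powR_mulrn _ (powR_ge0 l _)) -!powRrM mulrA.
have -> : n%:R * n%:R `^ (- a * 2) = n%:R `^ nu :> R.
  rewrite -{1}[n%:R](powRr1 (ltW n0)) -gt0_powRD//; congr (_ `^ _).
  by have := nu_a; lra.
rewrite /Lam /X /dim_scale -/l powRM ?invr_ge0 ?(ltW n0) ?(ltW l0)//.
rewrite -mulrA -mulrA; congr (_ * _).
have -> : l^-1 `^ nu = l `^ (- nu) by rewrite -powR_inv1 ?(ltW l0)// -powRrM mulN1r.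
transitivity (l `^ (- nu) * (l `^ 1 * l `^ (2 * (t - a)))); last by rewrite powRr1 ?(ltW l0).
rewrite -!gt0_powRD//.
by congr (_ `^ _); have := nu_a; lra.
Qed.

Let term3 : ((2 * n ^ A * n).+1 ^ m')%:R *
     ((1 + p^-1 * expR (x * 2 + Lam)) *
      expR (- (n%:R * (Num.min ((r ^+ 2 / 2 - s ^+ 2) / (16 * sigma ^+ 2)) (8 * L)^-1 / 2))))
   <= 2 * expR (- Lam).
Proof.
have -> : p^-1 = expR (c1 * Lam) by rewrite -expRN opprK.
have h1 : 1 + expR (c1 * Lam) * expR (x * 2 + Lam) <= 2 * expR ((c1 + 2 * S' + 1) * Lam).
  have : expR (c1 * Lam) * expR (x * 2 + Lam) <= expR ((c1 + 2 * S' + 1) * Lam).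
    by rewrite -expRD ler_expR; move: x_le; lra.
  have : 1 <= expR ((c1 + 2 * S' + 1) * Lam).
    rewrite -[leLHS]expR0 ler_expR mulr_ge0 ?(ltW Lam0)//.
    by rewrite /c1; move: b0_gt0 S'0; lra.
  by lra.
have h2 : (c3 + 1) * Lam <=
    n%:R * (Num.min ((r ^+ 2 / 2 - s ^+ 2) / (16 * sigma ^+ 2)) (8 * L)^-1 / 2).
  have sg : 0 < sigma ^+ 2 by rewrite exprn_gt0.
  (* The first entry of the minimum is handled by the surplus logarithm [ht], the second by
     [big3]. *)
  rewrite [leRHS]mulrA ler_pdivlMr// minr_pMr ?(ltW n0)// le_min; apply/andP; split.
    rewrite [leRHS]mulrA ler_pdivlMr ?mulr_gt0// mulrBr [n%:R * (r ^+ 2 / 2)]mulrA r_sqr.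
    have : Lam * (2 * (32 * sigma ^+ 2 * (c3 + 1) + S)) <= Lam * l `^ (2 * (t - a)).
      by rewrite ler_pM2l.
    have := s_sqr; move: (Lam * l `^ _) (n%:R * s ^+ 2) => u v.
    by move: (sigma ^+ 2) => w; lra.
  have L0 : 0 < L by apply: lt_le_trans L8; rewrite exprn_gt0.
  rewrite ler_pdivlMr; last by rewrite mulr_gt0.
  apply: le_trans big3.
  have -> : (c3 + 1) * Lam * 2 * (8 * L) =
    16 * 8 ^+ D * pi * (c3 + 1) * (n%:R `^ kp * X * l) * m'%:R.
    by rewrite /L /Lam; ring.
  have -> : 32 * 8 ^+ D * pi * kap%:R * (c3 + 1) * (X ^+ 2 * l * n%:R `^ kp) =
    16 * 8 ^+ D * pi * (c3 + 1) * (n%:R `^ kp * X * l) * (2 * kap%:R * X) by ring.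
  rewrite ler_wpM2l// !mulr_ge0 ?exprn_ge0 ?powR_ge0 ?pi_ge0 ?(ltW X0) ?(ltW l0)//.
  by move: c30; lra.
apply: (@le_trans _ _ (expR ((A%:R + 3) * (2 * kap%:R) * Lam) *
   ((2 * expR ((c1 + 2 * S' + 1) * Lam)) * expR (- ((c3 + 1) * Lam))))).
  rewrite ler_pM ?mulr_ge0 ?addr_ge0 ?mulr_ge0 ?expR_ge0//.
  by rewrite ler_pM ?addr_ge0 ?mulr_ge0 ?expR_ge0// ler_expR lerN2.
rewrite -[2 * _ * _]mulrA [leLHS]mulrCA -!expRD ler_wpM2l// ler_expR /c3; lra.
Qed.

Lemma rate_bound :
  ('E_(design_noise sigma n)[fun w =>
     posterior sigma (random_series_prior piN G) (data f0 w)
       [set f : R -> R | (r%:E < L2norm (f \- f0)%R)%E]] <= (5 * expR (- Lam))%:E)%E.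
Proof.
have n_gt0 : (0 < n)%N by exact: leq_trans n2.
(* The interval of radius [1 / n] has mass at least [2 * gm / n], which exceeds [n ^ -2] once
   [n >= 1 / (2 * gm)]. *)
have delta_ge0 : (0 : R) <= n%:R^-1 ^+ 2 by rewrite exprn_ge0.
have deltaG k : (1 <= k <= m)%N ->
    ((n%:R^-1 ^+ 2)%:E <= G [set x | (`|x - beta k| <= n%:R^-1)%R])%E.
  move=> /andP[k1 _]; apply: le_trans (G_interval k1 _); last first.
    by rewrite invr_gt0 n0 invf_le1.
  rewrite lee_fin expr2 [leRHS]mulrAC [leRHS]mulrC ler_pM2l ?invr_gt0//.
  by rewrite -[leRHS]invrK lef_pV2 ?posrE ?invr_gt0 ?mulr_gt0.
have e2P : (G [set x | ((n ^ A)%:R < `|x|)%R] <= e2%:E)%E.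
  apply: (le_trans (G_tail _)) => //; rewrite lee_fin ler_wpM2l ?(ltW K_gt0)//.
  rewrite ler_expR lerN2 ler_wpM2l ?divr_ge0 ?(ltW tau0_gt0)//.
  rewrite natrX -(powR_mulrn A (ltW n0)) -powRrM.
  apply: (@le_trans _ _ (n%:R `^ 1)); last exact: ler_powR.
  by rewrite powRr1// ltW.
have r_ge0 : 0 <= r by rewrite mulr_ge0 ?powR_ge0.
have := @expected_posterior_rate R sigma piN G sigma_gt0 piN_sum1 alpha Q f0 beta
  alpha_gt0 Q_gt0 f0_lim beta_sum n m m' A n_gt0 isT m_m' D (n%:R^-1 ^+ 2) p e1 e2 s L r Lam
  delta_ge0 deltaG (expR_gt0 _) p_le (piN_tail m'_ge2) e2P s1 s2 L8 r_ge0 L_large.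
move=> /le_trans; apply; rewrite lee_fin -/x.
apply: (le_trans (lerD (lerD (lexx _) term2) term3)).
by move: (expR (- Lam)) => z; lra.
Qed.

End rate.

(** * Passage to the limit *)

Lemma expected_posterior_ge0 (R : realType) (sigma : R) (Pi : {measure set coefs R -> \bar R})
    (f0 : R -> R) n (A : set (R -> R)) :
  (0 <= 'E_(design_noise sigma n)[fun w => posterior sigma Pi (data f0 w) A])%E.
Proof.
have lik0 (w : n.-tuple (R * R)) b : 0 <= likelihood sigma w b.
  by apply: prodr_ge0 => i _; exact: normal_pdf_ge0.
rewrite unlock; apply: integral_ge0 => w _; rewrite lee_fin divr_ge0// fine_ge0//.
  by apply: integral_ge0 => b _; rewrite lee_fin.
by apply: integral_ge0 => b _; rewrite lee_fin.
Qed.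

Theorem theorem3p1 (R : realType) (sigma : R) (sigma_gt0 : 0 < sigma)
    (tau tau0 : R) (tau_gt0 : 0 < tau) (tau0_gt0 : 0 < tau0)
    (g : R -> R)
    (g_prop : exists c : R, forall x, g x = c * expR (- (tau0 * `|x| `^ tau)))
    (G : probability (measurableTypeR R) R)
    (G_density : forall A : set (measurableTypeR R), measurable A ->
      G A = (\int[lebesgue_measure]_(x in A) (g x)%:E)%E)
    (piN : nat -> {nonneg R})
    (piN_sum1 : (\sum_(1 <= m <oo) ((piN m)%:num)%:E = 1)%E)
    (b0 b1 : R) (b0_gt0 : 0 < b0) (b1_gt0 : 0 < b1)
    (piN_lower : forall m : nat, (2 <= m)%N ->
      expR (- (b0 * m%:R * ln m%:R)) <= (piN m)%:num)
    (piN_tail : forall m : nat, (2 <= m)%N ->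
      (\sum_(m.+1 <= N <oo) ((piN N)%:num)%:E
        <= (expR (- (b1 * m%:R * ln m%:R)))%:E)%E)
    (alpha Q : R) (alpha_gt : 2^-1 < alpha) (Q_gt0 : 0 < Q)
    (f0 : R -> R) (f0_holder : holder_ball alpha Q f0) :
  exists M : R, 0 < M /\
    forall t : R, alpha / (2 * alpha + 1) < t ->
      ('E_(design_noise sigma n)[fun w =>
         posterior sigma (random_series_prior piN G) (data f0 w)
           [set f | ((M * n%:R `^ (- (alpha / (2 * alpha + 1)))
                        * (ln n%:R) `^ t)%:E < L2norm (f \- f0)%R)%E]]
       @[n --> \oo] --> 0)%E.
Proof.
have [c gE] := g_prop; have [beta [f0_lim beta_sum]] := f0_holder.
have alpha_gt0 : 0 < alpha by apply: lt_trans alpha_gt; rewrite invr_gt0.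
have c_gt0 := density_constant_gt0 gE G_density.
have [K K_gt0 G_tail] := tail_mass_le tau_gt0 tau0_gt0 gE G_density.
pose gm := c * expR (- (tau0 * (Q + 1) `^ tau)).
have gm_gt0 : 0 < gm by rewrite mulr_gt0 ?expR_gt0.
have G_interval k eta : (1 <= k)%N -> 0 < eta <= 1 ->
    ((2 * eta * gm)%:E <= G [set x | (`|x - beta k| <= eta)%R])%E.
  move=> k1 eta1; apply: (interval_mass_ge tau_gt0 tau0_gt0 gE G_density) => //.
  exact: (coefficient_le alpha_gt0 Q_gt0 beta_sum).
pose nu := (2 * alpha + 1)^-1.
have nu_gt0 : 0 < nu by rewrite invr_gt0; lra.
have nu_lt : nu < 2^-1.
  by rewrite ltf_pV2 ?posrE//; move: alpha_gt; rewrite -[2^-1]div1r ltr_pdivrMr//; lra.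
pose A := (Num.truncn tau^-1).+1.
have hA : 1 <= A%:R * tau.
  by rewrite -ler_pdivrMr// div1r; exact/ltW/Num.Theory.truncnS_gt.
pose S' := (2 + 2 * Q ^+ 2) / sigma ^+ 2.
pose c2 := 2 * b0 + 4 + S' + 1.
pose kap := (Num.truncn (2 * (c2 + 1) / (b1 * nu))).+1.
have hkap : 2 * (c2 + 1) <= kap%:R * (b1 * nu).
  by rewrite -ler_pdivrMr ?mulr_gt0//; exact/ltW/Num.Theory.truncnS_gt.
(* Half of the gap [1 - 2 * nu], which is positive because [alpha > 1/2]. *)
pose kp := (1 - 2 * nu) / 2.
have kp_gt0 : 0 < kp by rewrite /kp; lra.
have kp_lt : 2 * nu + kp < 1 by rewrite /kp; lra.
pose D := (Num.truncn ((A%:R + 3) / kp)).+1.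
have hD : A%:R + 3 <= kp * D%:R.
  by rewrite mulrC -ler_pdivrMr//; exact/ltW/Num.Theory.truncnS_gt.
pose c3 := (A%:R + 3) * (2 * kap%:R) + (2 * b0 + 4) + 2 * S' + 1.
have S'0 : 0 <= S'.
  by rewrite divr_ge0 ?sqr_ge0// addr_ge0// mulr_ge0// sqr_ge0.
have c30 : 0 <= c3 + 1.
  have : 0 <= (A%:R + 3) * (2 * kap%:R) :> R by rewrite !mulr_ge0// addr_ge0.
  by rewrite /c3; move: b0_gt0 S'0; lra.
have c20 : 0 <= c2 by rewrite /c2; move: b0_gt0 S'0; lra.
(* Since [t] strictly exceeds the rate exponent, the surplus power of the logarithm makes [M = 1]
   sufficient. *)
exists 1; split => // t t_gt.
apply: (@squeeze_cvge _ _ _ _ (cst 0%E) _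
  (fun n => (5 * expR (- (dim_scale nu n * ln (n%:R : R))))%:E)).
- near=> n; rewrite expected_posterior_ge0/=.
  have := @rate_bound R sigma piN G sigma_gt0 piN_sum1 b0 b1 b0_gt0 b1_gt0 piN_lower
    piN_tail alpha Q f0 beta alpha_gt Q_gt0 f0_lim beta_sum gm K tau tau0 gm_gt0 K_gt0
    tau0_gt0 G_interval G_tail kap A D kp t isT hA hkap kp_gt0 hD n.
  rewrite mul1r; apply.
  + by near: n; exact: nbhs_infty_ge.
  + by near: n; exact: near_ln_ge.
  + by near: n; exact: near_dim_scale_ge.
  + by rewrite -[leLHS]mul1r; near: n; apply: near_ln_le_powR; rewrite invr_gt0.
  + by near: n; apply: near_scale_le => //; rewrite mulr_ge0// exprn_ge0.
  + near: n; apply: near_scale_le => //; rewrite divr_ge0 ?(ltW tau0_gt0)//.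
    by rewrite mulr_ge0// !addr_ge0// ?mulr_ge0// ltW.
  + near: n; apply: near_scale_le => //.
    by rewrite !mulr_ge0 ?exprn_ge0 ?pi_ge0.
  + by near: n; exact: nbhs_infty_ger.
  + by near: n; exact: nbhs_infty_ger.
  + by near: n; exact: nbhs_infty_gtr.
  + by near: n; apply: near_ln_powR_ge; rewrite mulr_gt0// subr_gt0.
- exact: cvg_cst.
apply: cvg_EFin; first by near=> n.
apply/cvgrPdist_le => e e0; near=> n; rewrite sub0r normrN ger0_norm; last first.
  by rewrite mulr_ge0// expR_ge0.
have X1 : 5 / e <= dim_scale nu n by near: n; exact: near_dim_scale_ge.
have l1 : 1 <= ln (n%:R : R) by near: n; exact: near_ln_ge.
have Lam_ge : 5 / e <= dim_scale nu n * ln (n%:R : R).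
  by apply: (le_trans X1); rewrite ler_peMr// powR_ge0.
rewrite /= expRN ler_pdivrMr ?expR_gt0// mulrC -ler_pdivrMr//.
apply: le_trans (expR_ge1Dx _); apply: (le_trans Lam_ge).
by rewrite lerDr.
Unshelve. all: by end_near. Qed.
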